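(* Let $K \subset \mathbb{R}^d$ be a compact, convex, centrally symmetric set with nonempty interior. Let $v_1,\dots,v_n$ be independent symmetric isotropic random vectors in $\mathbb{R}^d$; that is, they are independent and, for each $j$, the random vectors $v_j$ and $-v_j$ have the same distribution and $\mathbb{E}\, v_j v_j^{\mathsf T} = I_d$. Then there exists an online algorithm that discards some of the steps $v_j$ (and accepts the others) such that, for each $k \in \{1,\dots,n\}$, $$\sum_{j \le k,\ j \text{ accepted}} v_j \in 2K \quad \text{deterministically},$$ and $$\mathbb{E}\,\#\{\text{discarded}\} \le \sqrt{\lambda_1(K)}\; n,$$ where $\lambda_1(K)$ is the first Dirichlet eigenvalue of $K$.
   Context: For a set $K$, $2K = \{2x : x \in K\}$; centrally symmetric means $K=-K$; $I_d$ is the $d\times d$ identity matrix. First Dirichlet eigenvalue: $$\lambda_1(K) = \inf\left\{ \int_K \|\nabla \psi\|_2^2\,dx \;:\; \psi \in C^\infty(\mathbb{R}^d),\ \operatorname{supp}(\psi) \subset \operatorname{int} K,\ \int_K \psi^2\,dx = 1\right\}.$$ Online algorithm: the steps $v_1, v_2,\dots$ are revealed one at a time. Upon observing $v_j$, the algorithm must immediately decide whether to accept or discard it; the decision may depend on the steps observed so far (and on internal randomness of the algorithm independent of the vectors $v_j$), but not on future steps, and it cannot be changed later. ''Deterministically'' means for every realization of the steps and of the internal randomness. The expectation is over the random vectors and the internal randomness, and $\#\{\text{discarded}\}$ is the number of indices $j\in\{1,\dots,n\}$ whose step is discarded. *)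

(* Defs.v *)
From HB Require Import structures.
From mathcomp Require Import all_boot all_order all_algebra.
From mathcomp Require Import all_classical all_reals all_analysis.

Set Implicit Arguments.
Unset Strict Implicit.
Unset Printing Implicit Defensive.

Import Order.TTheory GRing.Theory Num.Theory.
Import numFieldNormedType.Exports.

Local Open Scope classical_set_scope.
Local Open Scope ring_scope.
Local Open Scope ereal_scope.

(* R^d is 'rV[R]_d, so that the outer product x x^T of a vector with itself is
   x^T *m x below. It carries its Borel sigma-algebra. *)
HB.instance Definition _ (R : realType) (m n : nat) :=
  @isMeasurable.Build (sigma_display (@open 'M[R]_(m, n))) 'M[R]_(m, n)
    <<s (@open 'M[R]_(m, n)) >>
    (@sigma_algebra0 _ setT (@open 'M[R]_(m, n)))
    (@sigma_algebraC _ (@open 'M[R]_(m, n)))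
    (@sigma_algebra_bigcup _ setT (@open 'M[R]_(m, n))).

(* d-fold product of the Lebesgue measure of R, transported to 'rV[R]_d
   along (y, t) |-> (t, y_1, ..., y_d). *)
Fixpoint lebesgue_rV (R : realType) (d : nat) : set 'rV[R]_d -> \bar R :=
  match d with
  | 0 => \d_(0%R : 'rV[R]_0)
  | d'.+1 =>
      pushforward (@lebesgue_rV R d' \x @lebesgue_measure R)
        (fun p : 'rV[R]_d' * measurableTypeR R =>
           row_mx (p.2%:M : 'rV[R]_1) p.1)
  end.

Section dirichlet_eigenvalue.
Context {R : realType} {d : nat}.
Implicit Types (psi : 'rV[R]_d -> R) (K : set 'rV[R]_d).

Definition partial (i : 'I_d) psi : 'rV[R]_d -> R :=
  'D_(delta_mx ord0 i) psi.

Definition iter_partial (s : seq 'I_d) psi : 'rV[R]_d -> R :=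
  foldr partial psi s.

(* C^oo: every iterated partial derivative exists everywhere and is
   continuous. *)
Definition smooth psi : Prop := forall s : seq 'I_d,
  continuous (iter_partial s psi) /\
  (forall i x, derivable (iter_partial s psi) x (delta_mx ord0 i)).

Definition supp psi : set 'rV[R]_d := closure [set x | psi x != 0%R].

Definition sqr_norm_grad psi (x : 'rV[R]_d) : R :=
  (\sum_(i < d) partial i psi x ^+ 2)%R.

Definition dirichlet_energy K psi : \bar R :=
  \int[@lebesgue_rV R d]_(x in K) (sqr_norm_grad psi x)%:E.

Definition lambda1 K : \bar R :=
  ereal_inf [set dirichlet_energy K psi | psi in
    [set psi | [/\ smooth psi, supp psi `<=` K° &
      \int[@lebesgue_rV R d]_(x in K) (psi x ^+ 2)%:E = 1]]].

End dirichlet_eigenvalue.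

Section random_vectors.
Context {dT : measure_display} {T : measurableType dT} {R : realType}
  {P : probability T R} {d : nat}.

Definition mutually_independent (n : nat)
    (v : 'I_n -> {RV P >-> 'rV[R]_d}) : Prop :=
  forall (J : {set 'I_n}) (B : 'I_n -> set 'rV[R]_d),
    (forall j, measurable (B j)) ->
    P (\bigcap_(j in [set` J]) (v j @^-1` B j)) =
    \prod_(j in J) P (v j @^-1` B j).

Definition symmetric_rv (X : {RV P >-> 'rV[R]_d}) : Prop :=
  forall B : set 'rV[R]_d, measurable B ->
    distribution P X B = pushforward P (fun w => (- X w)%R) B.

(* An undefined expectation (oo - oo) has value -oo in the library, so these
   equations also assert that the entries of X X^T are integrable. *)
Definition isotropic_rv (X : {RV P >-> 'rV[R]_d}) : Prop :=
  forall i k : 'I_d,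
    'E_P[(fun w => ((X w)^T *m X w)%R i k)] = ((1%:M : 'M[R]_d) i k)%:E.

End random_vectors.

(* A decision rule: given the internal randomness u and the sequence
   [:: x_1; ...; x_j] of the steps observed so far, it tells whether the
   latest step x_j is accepted. Past decisions are functions of the same data,
   hence need not be passed along. *)
Record online_algorithm {dE dU : measure_display}
    (E : measurableType dE) (U : measurableType dU) := OnlineAlgorithm {
  decide :> U -> seq E -> bool ;
  measurable_decide : forall k : nat,
    measurable_fun [set: U * k.-tuple E] (fun p => decide p.1 p.2)
}.

Section run.
Context {dE dU : measure_display} {E : measurableType dE}
  {U : measurableType dU} {n : nat}.
Variables (A : online_algorithm E U) (u : U) (x : n.-tuple E).

Definition accepted (j : 'I_n) : bool := A u (take j.+1 x).

Definition num_discarded : nat := #|[set j : 'I_n | ~~ accepted j]%SET|.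

End run.

(* Main.v *)
Require Import Defs.
From HB Require Import structures.
From mathcomp Require Import all_boot all_order all_algebra.
From mathcomp Require Import all_classical all_reals all_analysis.
From mathcomp Require Import measurable_realfun lra ring.

(** The algorithm keeps a point X of K and accepts a step exactly when a
    suitable rule lets X move along it. Then the sum of the accepted steps is
    the difference of two points of K, and by convexity and symmetry such a
    difference lies in 2K.

    The starting point is random, with density psi ^+ 2 for a test function psi
    of the eigenvalue problem, and the rule is that of slice sampling: the
    internal randomness is a point (x, y) uniform on the region under the graph
    of psi ^+ 2, the height y never changes, and a step v is accepted when
    (x + v, y) is still under the graph. A step and its opposite are equally
    likely, so moving along v and moving back balance each other and the uniform
    law on the region is stationary (walk_step_stationary). The state before
    step k depends only on the internal randomness and the earlier steps, so it
    is independent of v_k and its law is still uniform (state_law).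

    Hence step v_k is discarded with probability
    E int max (psi(x) ^+ 2 - psi(x + v) ^+ 2) 0 dx, half the L1 distance between
    psi ^+ 2 and its translate. Factoring the difference of squares and using
    the inequality between arithmetic and geometric means (loss_le) bounds it by
    means of D = E int (psi(x + v) - psi(x)) ^+ 2 dx. Writing an increment as
    the integral of a directional derivative, and averaging with isotropy, gives
    D <= int |grad psi| ^+ 2 (increment_le_energy).

    The infimum defining lambda_1 need not be attained, but the square-root
    bound is obtained with room to spare: in the identity
    int (psi_v - psi) ^+ 2 + int (psi_v + psi) ^+ 2 = 4, where psi_v is the
    translate of psi, the second term is on average smaller than 4 by D. When
    0 < lambda_1 < 1 it is therefore enough that the energy of psi be at most
    lambda_1 + lambda_1 ^+ 2 / 4 (gain_le). When lambda_1 >= 1 all steps may be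
    discarded. In positive dimension lambda_1 is positive, because a translate
    of psi by a vector longer than the width of K is orthogonal to psi
    (two_le_energy); in dimension 0 every sum vanishes. *)

Set Implicit Arguments.
Unset Strict Implicit.
Unset Printing Implicit Defensive.

Import Order.TTheory GRing.Theory Num.Theory.
Import numFieldNormedType.Exports.

Local Open Scope classical_set_scope.
Local Open Scope ring_scope.
Local Open Scope ereal_scope.

(** * Borel measurability of matrix-valued maps *)

Section borel_matrices.
Context {R : realType} {m n : nat}.

Lemma measurable_open_mx (A : set 'M[R]_(m, n)) : open A -> measurable A.
Proof. exact: sub_sigma_algebra. Qed.

Lemma continuous_measurable_mx (f : 'M[R]_(m, n) -> R) :
  continuous f -> measurable_fun setT f.
Proof.
move=> /continuousP cf; apply: (measurability _ (RGenOpens.measurableE R)).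
move=> _ [_ [a [b ->] <-]]; rewrite setTI; apply: measurable_open_mx.
exact/cf/interval_open.
Qed.

Lemma measurable_coord (i : 'I_m) (j : 'I_n) :
  measurable_fun setT (fun M : 'M[R]_(m, n) => M i j).
Proof. by apply: continuous_measurable_mx; exact: coord_continuous. Qed.

(** The cubes with rational centre and radius 1/(N+1) are a countable basis of
    the topology, which is what reduces measurability to the coordinates. *)
Lemma open_mx_rat_cubes (A : set 'M[R]_(m, n)) : open A ->
  A = \bigcup_(q in [set q : 'M[rat]_(m, n) * nat |
         ball (map_mx ratr q.1 : 'M[R]_(m, n)) q.2.+1%:R^-1%R `<=` A])
       ball (map_mx ratr q.1 : 'M[R]_(m, n)) q.2.+1%:R^-1%R.
Proof.
move=> oA; apply/seteqP; split=> [x Ax|x [q] /= qA qx]; last exact: qA.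
have /nbhs_ballP[e /= e0 xeA] := open_nbhs_nbhs (conj oA Ax).
have [N Ne] : exists N : nat, (N.+1%:R^-1 < e / 2 :> R)%R.
  have e20 : (0 < e / 2)%R by rewrite divr_gt0.
  exists (Num.truncn (e / 2)^-1); rewrite invf_plt ?posrE//.
  exact: truncnS_gt.
have qP i j : exists q : rat, (ball (ratr q : R) N.+1%:R^-1%R (x i j)).
  have N0 : (0 < N.+1%:R^-1 :> R)%R by rewrite invr_gt0.
  have [|q] := @rat_in_itvoo R (x i j - N.+1%:R^-1)%R (x i j + N.+1%:R^-1)%R.
    by rewrite ltrBlDr -addrA ltrDl addr_gt0.
  rewrite in_itv/= => /andP[q1 q2]; exists q.
  by rewrite /ball/= ltr_distl; apply/andP; split.
pose q := \matrix_(i, j) projT1 (cid (qP i j)).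
have qx : ball (map_mx ratr q : 'M[R]_(m, n)) N.+1%:R^-1%R x.
  split=> [|i j]; first by rewrite invr_gt0.
  by rewrite !mxE; case: cid.
exists (q, N) => // y qy; apply: xeA.
have : ball x (N.+1%:R^-1 + N.+1%:R^-1)%R y.
  exact: ball_triangle (ball_sym qx) qy.
by apply: le_ball; rewrite ltW// [ltRHS]splitr ltrD.
Qed.

Lemma measurable_fun_mx {d} {T : measurableType d} (f : T -> 'M[R]_(m, n)) :
  (forall i j, measurable_fun setT (fun t => f t i j)) -> measurable_fun setT f.
Proof.
have mE : @measurable _ 'M[R]_(m, n) = <<s @open 'M[R]_(m, n) >> by [].
move=> mf; apply: (measurability _ mE) => _ [A oA <-].
rewrite setTI (open_mx_rat_cubes oA) preimage_bigcup bigcup_mkcond.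
apply: countable_bigcupT_measurable => [//|[q N]]; case: ifP => // _.
rewrite (_ : _ @^-1` _ = \bigcap_(ij in [set: 'I_m * 'I_n])
    ((fun t => f t ij.1 ij.2) @^-1` ball (ratr (q ij.1 ij.2) : R) N.+1%:R^-1%R)).
  apply: fin_bigcap_measurable => // ij _; rewrite -[X in measurable X]setTI.
  by apply: mf => //; apply: measurable_ball.
apply/seteqP; split => t /=.
  by move=> [_ qt] [i j] _ /=; have := qt i j; rewrite mxE.
by move=> qt; split => [|i j]; rewrite ?invr_gt0// mxE; exact: (qt (i, j)).
Qed.

Lemma measurable_addmx {d} {T : measurableType d} (f g : T -> 'M[R]_(m, n)) :
  measurable_fun setT f -> measurable_fun setT g ->
  measurable_fun setT (fun t => f t + g t)%R.
Proof.
move=> mf mg; apply: measurable_fun_mx => i j.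
under eq_fun do rewrite mxE.
by apply: measurable_funD; apply: measurableT_comp (measurable_coord i j) _.
Qed.

Lemma measurable_oppmx {d} {T : measurableType d} (f : T -> 'M[R]_(m, n)) :
  measurable_fun setT f -> measurable_fun setT (fun t => - f t)%R.
Proof.
move=> mf; apply: measurable_fun_mx => i j.
under eq_fun do rewrite mxE.
by apply: measurable_funN; apply: measurableT_comp (measurable_coord i j) _.
Qed.

Lemma measurable_scalemx {d} {T : measurableType d} (a : T -> R)
    (f : T -> 'M[R]_(m, n)) :
  measurable_fun setT a -> measurable_fun setT f ->
  measurable_fun setT (fun t => a t *: f t)%R.
Proof.
move=> ma mf; apply: measurable_fun_mx => i j.
under eq_fun do rewrite mxE.
by apply: measurable_funM => //; apply: measurableT_comp (measurable_coord i j) _.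
Qed.

End borel_matrices.

(** * Lebesgue measure on row vectors *)

Lemma measurable_preimage {d1 d2} {T1 : measurableType d1}
    {T2 : measurableType d2} (f : T1 -> T2) (A : set T2) :
  measurable_fun setT f -> measurable A -> measurable (f @^-1` A).
Proof. by move=> mf mA; rewrite -[X in measurable X]setTI; exact: mf. Qed.

Definition preserves_measure {d} {T : measurableType d} {R : realType}
    (mu : set T -> \bar R) (f : T -> T) :=
  measurable_fun setT f /\
  forall A, measurable A -> mu (f @^-1` A) = mu A.

Lemma preserves_product {d1 d2} {T1 : measurableType d1}
    {T2 : measurableType d2} {R : realType}
    (m1 : {sigma_finite_measure set T1 -> \bar R})
    (m2 : {sigma_finite_measure set T2 -> \bar R}) (f1 : T1 -> T1)
    (f2 : T2 -> T2) :
  preserves_measure m1 f1 -> preserves_measure m2 f2 ->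
  preserves_measure (m1 \x m2) (fun p => (f1 p.1, f2 p.2)).
Proof.
move=> [mf1 f1P] [mf2 f2P].
have mf : measurable_fun setT (fun p : T1 * T2 => (f1 p.1, f2 p.2)).
  by apply: measurable_fun_pair; exact: measurableT_comp.
split=> // A mA; apply/esym.
apply: (@product_measure_unique _ _ _ _ _ m1 m2
  (pushforward (m1 \x m2) (fun p => (f1 p.1, f2 p.2)))) => // B C mB mC.
transitivity ((m1 \x m2) ((f1 @^-1` B) `*` (f2 @^-1` C))) => //.
rewrite product_measure1E; [|exact: measurable_preimage..].
by congr (_ * _); [exact: f1P|exact: f2P].
Qed.

Section product_sigma_finite.
Context {d1 d2} {T1 : measurableType d1} {T2 : measurableType d2} {R : realType}
  (m1 : {sigma_finite_measure set T1 -> \bar R})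
  (m2 : {sigma_finite_measure set T2 -> \bar R}).

(** The canonical sigma-finite structure of a bare product is that of a product
    of subprobabilities; this name carries the general one. *)
Definition sigma_finite_product : set (T1 * T2) -> \bar R := m1 \x m2.

HB.instance Definition _ := Measure.on sigma_finite_product.

Let sigma_finite_setT : sigma_finite setT sigma_finite_product.
Proof.
have /sigma_finiteP[F [FT ndF Foo]] := sigma_finiteT m1.
have /sigma_finiteP[G [GT ndG Goo]] := sigma_finiteT m2.
exists (fun k => F k `*` G k).
  apply/seteqP; split=> // -[x y] _.
  have [i _ Fx] : (\bigcup_i F i) x by rewrite -FT.
  have [j _ Gy] : (\bigcup_i G i) y by rewrite -GT.
  exists (maxn i j) => //; split => /=.
    by apply: (subsetPset _ _ (ndF _ _ (leq_maxl i j))).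
  by apply: (subsetPset _ _ (ndG _ _ (leq_maxr i j))).
move=> k; have [mF Fk] := Foo k; have [mG Gk] := Goo k; split.
  exact: measurableX.
by rewrite [ltLHS]product_measure1E// lte_mul_pinfty// ge0_fin_numE.
Qed.

HB.instance Definition _ :=
  Measure_isSigmaFinite.Build _ _ _ sigma_finite_product sigma_finite_setT.

End product_sigma_finite.

Lemma lebesgue_measure_shift {R : realType} (a : R) :
  preserves_measure (@lebesgue_measure R) (fun x => x + a)%R.
Proof.
have mf : measurable_fun setT (fun x : measurableTypeR R => x + a : measurableTypeR R)%R.
  by apply: measurable_funD.
split=> // A mA.
apply/esym; apply: (@lebesgue_measure_unique R (pushforward lebesgue_measure
  (fun x : measurableTypeR R => x + a : measurableTypeR R)%R)) => //= _ [[b c]] _ <-.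
transitivity (lebesgue_measure `]b - a, c - a]%classic)%R; last first.
  congr lebesgue_measure.
  by apply/seteqP; split => x /=; rewrite !in_itv/= ltrBlDr lerBrDr.
rewrite !lebesgue_measure_itv/=.
rewrite !lte_fin ltrD2r; case: ifP => // _.
by rewrite -!EFinB; congr EFin; ring.
Qed.

Section pushforward_is_measure.
Context {d1 d2} {T1 : measurableType d1} {T2 : measurableType d2}
  {R : realType} (mu : {measure set T1 -> \bar R}) (f : T1 -> T2)
  (mf : measurable_fun setT f).

Lemma pushforward_is_measure :
  exists nu : {measure set T2 -> \bar R}, (nu : set T2 -> \bar R) = pushforward mu f.
Proof. by unshelve eexists (pushforward mu f). Qed.

End pushforward_is_measure.

Section pushforward_sigma_finite.
Context {d1 d2} {T1 : measurableType d1} {T2 : measurableType d2} {R : realType}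
  (mu : {sigma_finite_measure set T1 -> \bar R}) (f : T1 -> T2) (g : T2 -> T1)
  (mf : measurable_fun setT f) (mg : measurable_fun setT g) (fK : cancel f g).

(** A separate name carries the sigma-finite structure, which depends on the
    inverse g and must not become the structure of every pushforward. *)
Definition transported_measure : set T2 -> \bar R := pushforward mu f.

Let nu0 : transported_measure set0 = 0.
Proof. by rewrite /transported_measure /pushforward preimage_set0 measure0. Qed.

Let nu_ge0 A : 0 <= transported_measure A.
Proof. exact: measure_ge0. Qed.

Let nu_sigma_additive : semi_sigma_additive transported_measure.
Proof.
have [m mE] := pushforward_is_measure mu mf.
by rewrite /transported_measure -mE; exact: measure_semi_sigma_additive.
Qed.

HB.instance Definition _ := isMeasure.Build _ _ _ transported_measure
  nu0 nu_ge0 nu_sigma_additive.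

Let sigma_finite_nu : sigma_finite setT transported_measure.
Proof.
have [F FT Foo] := sigma_finiteT mu.
exists (fun k => g @^-1` F k).
  by rewrite -preimage_bigcup -FT preimage_setT.
move=> k; have [mF Fk] := Foo k; split; first exact: measurable_preimage.
rewrite /transported_measure /pushforward -comp_preimage.
by rewrite (_ : _ \o _ = id)//; apply/funext => p; exact: fK.
Qed.

HB.instance Definition _ :=
  Measure_isSigmaFinite.Build _ _ _ transported_measure sigma_finite_nu.

Lemma pushforward_sigma_finite :
  exists m : {sigma_finite_measure set T2 -> \bar R},
    (m : set T2 -> \bar R) = pushforward mu f.
Proof. by exists transported_measure. Qed.

End pushforward_sigma_finite.

Section lebesgue_rV_measure.
Context {R : realType}.

Let cons_rV {d} (p : 'rV[R]_d * measurableTypeR R) : 'rV[R]_d.+1 :=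
  row_mx (p.2%:M : 'rV[R]_1) p.1.

Let measurable_cons_rV d : measurable_fun setT (@cons_rV d).
Proof.
apply: measurable_fun_mx => i j; rewrite /cons_rV.
case: (@split_ordP 1 d j) => k ->.
  under eq_fun do rewrite (@row_mxEl _ 1 1 d) !mxE !ord1 eqxx mulr1n.
  exact: measurable_snd.
under eq_fun do rewrite (@row_mxEr _ 1 1 d).
by apply: measurableT_comp (measurable_coord i k) _.
Qed.

Let uncons_rV {d} (x : 'rV[R]_d.+1) : 'rV[R]_d * measurableTypeR R :=
  (rsubmx (x : 'rV_(1 + d)), x ord0 ord0).

Let measurable_uncons_rV d : measurable_fun setT (@uncons_rV d).
Proof.
apply: measurable_fun_pair; last exact: measurable_coord.
apply: measurable_fun_mx => i j; under eq_fun do rewrite mxE.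
exact: measurable_coord.
Qed.

Let uncons_rVK d : cancel (@uncons_rV d) (@cons_rV d).
Proof.
move=> x; rewrite /cons_rV /uncons_rV /=.
rewrite -[RHS](@hsubmxK _ 1 1 d x); congr (@row_mx _ 1 1 d _ _).
apply/rowP => i; rewrite !mxE !ord1 mulr1n; congr (x _ _); exact/val_inj.
Qed.

Let cons_rVK d : cancel (@cons_rV d) (@uncons_rV d).
Proof.
move=> [y t]; rewrite /uncons_rV /cons_rV /= row_mxKr; congr pair.
rewrite (_ : @ord0 d = @lshift 1 d (ord0 : 'I_1)); last exact/val_inj.
by rewrite (@row_mxEl _ 1 1 d) mxE eqxx mulr1n.
Qed.

Let cons_rVD d (p q : 'rV[R]_d * measurableTypeR R) :
  cons_rV (p.1 + q.1, p.2 + q.2)%R = (cons_rV p + cons_rV q)%R.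
Proof.
rewrite /cons_rV (@add_row_mx _ 1 1 d); congr (@row_mx _ 1 1 d _ _).
by apply/matrixP => i j; rewrite !mxE mulrnDl.
Qed.

(** Both properties are proved in the same induction on the dimension: a measure
    structure in dimension d is needed to speak of the product that defines the
    measure in dimension d.+1, and translations act on its factors separately. *)
Lemma lebesgue_rV_structure d :
  exists mu : {sigma_finite_measure set 'rV[R]_d -> \bar R},
    (mu : set _ -> \bar R) = @lebesgue_rV R d /\
    forall a, preserves_measure mu (fun x => x + a)%R.
Proof.
elim: d => [|d [mu [muE muD]]].
  exists (\d_(0%R : 'rV[R]_0)); split=> // a; split.
    exact: measurable_addmx.
  move=> A mA; congr dirac; apply/funext => x; rewrite /preimage /mkset.
  by rewrite (_ : (x + a)%R = x)//; apply/rowP => -[].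
have [nu nuE] := pushforward_sigma_finite
  (sigma_finite_product mu (@lebesgue_measure R))
  (@measurable_cons_rV d) (@measurable_uncons_rV d) (@cons_rVK d).
exists nu; split; first by rewrite nuE /= -muE.
move=> a; split; first exact: measurable_addmx.
have [_ sP] := preserves_product (muD (uncons_rV a).1)
  (lebesgue_measure_shift (uncons_rV a).2).
move=> A mA; rewrite nuE /pushforward.
rewrite (_ : _ @^-1` (_ @^-1` A) =
    (fun p => (p.1 + (uncons_rV a).1, p.2 + (uncons_rV a).2)%R) @^-1`
    (@cons_rV d @^-1` A)).
  by apply: sP; exact: measurable_preimage.
by apply/funext => p; rewrite /preimage /mkset cons_rVD uncons_rVK.
Qed.

Context {d : nat}.

Let lebesgue_rV0 : @lebesgue_rV R d set0 = 0.
Proof. by have [mu [<- _]] := lebesgue_rV_structure d; rewrite measure0. Qed.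

Let lebesgue_rV_ge0 A : 0 <= @lebesgue_rV R d A.
Proof. by have [mu [<- _]] := lebesgue_rV_structure d. Qed.

Let lebesgue_rV_sigma_additive : semi_sigma_additive (@lebesgue_rV R d).
Proof.
have [mu [<- _]] := lebesgue_rV_structure d.
exact: measure_semi_sigma_additive.
Qed.

HB.instance Definition _ := isMeasure.Build _ _ _ (@lebesgue_rV R d)
  lebesgue_rV0 lebesgue_rV_ge0 lebesgue_rV_sigma_additive.

Let sigma_finite_lebesgue_rV : sigma_finite setT (@lebesgue_rV R d).
Proof. by have [mu [<- _]] := lebesgue_rV_structure d; exact: sigma_finiteT. Qed.

HB.instance Definition _ := Measure_isSigmaFinite.Build _ _ _ (@lebesgue_rV R d)
  sigma_finite_lebesgue_rV.

Lemma lebesgue_rV_shift (a : 'rV[R]_d) :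
  preserves_measure (@lebesgue_rV R d) (fun x => x + a)%R.
Proof. by have [mu [<- muD]] := lebesgue_rV_structure d; exact: muD. Qed.

End lebesgue_rV_measure.

Lemma preserves_ge0_integral {d} {T : measurableType d} {R : realType}
    (mu : {measure set T -> \bar R}) (f : T -> T) (h : T -> \bar R) :
  preserves_measure mu f -> measurable_fun setT h -> (forall x, 0 <= h x) ->
  \int[mu]_x h (f x) = \int[mu]_x h x.
Proof.
move=> [mf fP] mh h0.
rewrite -[LHS](ge0_integral_pushforward mf mu measurableT mh) => [|x _]; last exact: h0.
by apply: eq_measure_integral => A mA _; exact: fP.
Qed.

(** * Directional derivatives of smooth functions *)

Local Close Scope ereal_scope.

Section directional_derivative.
Context {R : realType} {V : normedModType R}.
Implicit Types (f g : V -> R) (x v w : V).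

(** Restriction to a line turns directional derivatives into derivatives of real
    functions, for which the chain rule and the mean value theorem exist. *)
Lemma is_derive_line f x v (t l : R) :
  is_derive (x + t *: v) v f l <->
  is_derive t 1 (fun s => f (x + s *: v)) l.
Proof.
have E : (fun h : R => h^-1 *: ((f \o shift (x + t *: v)) (h *: v) - f (x + t *: v)))
  = (fun h : R => h^-1 *: (((fun s => f (x + s *: v)) \o shift t) (h *: 1)
       - f (x + t *: v))).
  apply/funext => h /=; congr (_ *: (f _ - _)).
  by rewrite [h *: 1]mulr1 scalerDl addrCA.
split=> -[fd fv]; split.
- by rewrite /derivable -E.
- by rewrite -fv /derive -E.
- by rewrite /derivable E.
- by rewrite -fv /derive E.
Qed.

Lemma is_derive_scale f x v (a l : R) :
  is_derive x v f l -> is_derive x (a *: v) f (a * l).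
Proof.
move=> fl.
have {}fl : is_derive (a * 0) 1 (fun s => f (x + s *: v)) l.
  by apply/is_derive_line; rewrite mulr0 scale0r addr0.
suff : is_derive (0 : R) 1 (fun s => f (x + s *: (a *: v))) (a * l).
  by move/is_derive_line; rewrite scale0r addr0.
rewrite (_ : (fun s => _) = (fun s => f (x + s *: v)) \o ( *%R a)); last first.
  by apply/funext => s /=; rewrite scalerA mulrC.
rewrite mulrC; apply: is_derive1_comp.
rewrite -[X in is_derive _ _ _ X]mulr1.
exact: is_deriveZ.
Qed.

Lemma mean_value_dir f (g : V -> R) x v :
  (forall x, is_derive x v f (g x)) ->
  exists2 c : R, 0 <= c <= 1 & f (x + v) - f x = g (x + c *: v).
Proof.
move=> fg.
have fl (t : R) : is_derive t 1 (fun s => f (x + s *: v)) (g (x + t *: v)).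
  exact/is_derive_line.
have [|c] := @MVT_segment R (fun s => f (x + s *: v)) (fun t => g (x + t *: v))
    0 1 ler01 (fun t _ => fl t).
  by apply: derivable_within_continuous => t _; have [] := fl t.
rewrite in_itv/= => c01; rewrite scale1r scale0r addr0 subr0 mulr1 => fE.
by exists c.
Qed.

(** The increment along v + w splits as an increment along w from a moving base
    point, which the mean value theorem turns into a nearby value of k, followed
    by an increment along v. *)
Lemma is_derive_add f (g k : V -> R) v w :
  continuous k ->
  (forall x, is_derive x v f (g x)) -> (forall x, is_derive x w f (k x)) ->
  forall x, is_derive x (v + w) f (g x + k x).
Proof.
move=> kc fg fk x.
have gq : (fun h => h^-1 *: (f (h *: v + x) - f x)) @ 0^' --> g x.
  by have [fd <-] := fg x; exact: fd.
pose u h := h^-1 *: (f (h *: (v + w) + x) - f (h *: v + x)).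
have uq : u @ 0^' --> k x.
  apply/cvgrPdist_le => e e0.
  have S0 : 0 < `|v| + `|w| + 1 by rewrite ltr_wpDl ?addr_ge0.
  have /cvgrPdist_le/(_ _ e0)/nbhs_ballP[r /= r0 kr] := kc x.
  near=> h.
  have h0 : h != 0 by near: h; exact: nbhs_dnbhs_neq.
  have [c /andP[c0 c1]] := mean_value_dir (h *: v + x)
    (fun y => is_derive_scale h (fk y)).
  rewrite (_ : h *: v + x + h *: w = h *: (v + w) + x); last first.
    by rewrite scalerDr addrAC.
  rewrite /u => ->; rewrite [_ *: _]mulrA mulVf// mul1r; apply: kr.
  rewrite -ball_normE /ball_/= [h *: v + x]addrC -addrA opprD addNKr normrN.
  rewrite (le_lt_trans (ler_normD _ _))// !normrZ.
  apply: (@le_lt_trans _ _ (`|h| * (`|v| + `|w| + 1))).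
    rewrite !mulrDr mulr1 -addrA lerD2l; apply: (@le_trans _ _ (`|h| * `|w|)).
      by rewrite ler_piMl ?mulr_ge0// ger0_norm.
    by rewrite lerDl.
  by rewrite -ltr_pdivlMr//; near: h; apply: dnbhs0_lt; exact: divr_gt0.
have fq : (fun h => h^-1 *: (f (h *: (v + w) + x) - f x)) @ 0^' --> g x + k x.
  rewrite (_ : (fun h => _) =
      (fun h => h^-1 *: (f (h *: v + x) - f x) + u h)); last first.
    apply/funext => h; rewrite /u -scalerDr; congr (_ *: _).
    by rewrite [RHS]addrC subrKA.
  exact: cvgD.
split; first by apply/cvg_ex; exists (g x + k x).
exact: cvg_lim fq.
Unshelve. all: by end_near.
Qed.

Lemma is_derive_dir0 f x : is_derive x 0 f 0.
Proof. by split; [exact: derivable0|exact: derive0]. Qed.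

End directional_derivative.

Section smooth_functions.
Context {R : realType} {d : nat} {psi : 'rV[R]_d -> R} (psiS : smooth psi).

Definition dir_derivative (v x : 'rV[R]_d) : R :=
  \sum_(i < d) v ord0 i * partial i psi x.

Lemma smooth_continuous : continuous psi.
Proof. by have [] := psiS [::]. Qed.

Lemma partial_continuous i : continuous (partial i psi).
Proof. by have [] := psiS [:: i]. Qed.

(** Continuity of the partial derivatives is what makes the derivative additive
    in the direction, hence the joint induction over the coordinates. *)
Let partial_sum_derivative (v : 'rV[R]_d) (s : seq 'I_d) :
  continuous (fun y => \sum_(i <- s) v ord0 i * partial i psi y) /\
  forall y, is_derive y (\sum_(i <- s) v ord0 i *: delta_mx ord0 i) psi
    (\sum_(i <- s) v ord0 i * partial i psi y).
Proof.
elim: s => [|i s [IHc IHd]].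
  split=> y; last by rewrite !big_nil; exact: is_derive_dir0.
  by under eq_fun do rewrite big_nil; exact: cst_continuous.
split=> y.
  under eq_fun do rewrite big_cons.
  have pc : {for y, continuous (fun y => v ord0 i * partial i psi y)}.
    by apply: continuousM; [exact: cst_continuous|exact: partial_continuous].
  exact: (continuousD pc (IHc y)).
rewrite !big_cons; apply: (@is_derive_add _ _ psi (fun z => v ord0 i * partial i psi z)
  (fun z => \sum_(j <- s) v ord0 j * partial j psi z)) => // z.
apply: is_derive_scale; apply: derivableP.
by have [_] := psiS [::]; apply.
Qed.

Lemma dir_derivative_continuous v : continuous (dir_derivative v).
Proof. exact: (partial_sum_derivative v (index_enum _)).1. Qed.

Lemma is_derive_dir_derivative v x : is_derive x v psi (dir_derivative v x).
Proof.
rewrite {1}[v]row_sum_delta.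
exact: (partial_sum_derivative v (index_enum _)).2.
Qed.

(** The increment is the integral over [0, 1] of the derivative along v. *)
Lemma sqr_increment_le v x :
  (((psi (x + v) - psi x) ^+ 2)%:E <=
   \int[@lebesgue_measure R]_(t in `[0%R, 1%R]) (dir_derivative v (x + t *: v) ^+ 2)%:E)%E.
Proof.
pose phi t := dir_derivative v (x + t *: v).
have phic : continuous phi.
  move=> t; apply: continuous_comp; last exact: dir_derivative_continuous.
  by apply: cvgD; [exact: cvg_cst|apply: cvgZr_tmp; exact: cvg_id].
have phiD (t : R) : is_derive t 1 (fun s => psi (x + s *: v)) (phi t) :=
  (is_derive_line psi x v t (phi t)).1 (is_derive_dir_derivative v (x + t *: v)).
have FTC : (\int[@lebesgue_measure R]_(t in `[0%R, 1%R]) (phi t)%:E =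
    (psi (x + v) - psi x)%:E)%E.
  rewrite (@continuous_FTC2 R phi (fun s => psi (x + s *: v)))//.
  - by rewrite scale1r scale0r addr0.
  - exact: continuous_subspaceT.
  - split=> [t _| |]; first by have [] := phiD t.
    + apply: cvg_at_right_filter; have [dt _] := phiD 0.
      exact: (differentiable_continuous ((derivable1_diffP _ _).1 dt)).
    + apply: cvg_at_left_filter; have [dt _] := phiD 1.
      exact: (differentiable_continuous ((derivable1_diffP _ _).1 dt)).
  - by move=> t _; rewrite derive1E; have [_] := phiD t.
set D := psi (x + v) - psi x in FTC *.
have phi2c : continuous (fun t => phi t ^+ 2).
  move=> t; apply: (@continuous_comp _ _ _ phi (fun r => r ^+ 2)).
    exact: phic.
  exact: exprn_continuous.
have intc (h : R -> R) : continuous h ->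
    lebesgue_measure.-integrable `[0%R, 1%R] (fun t => (h t)%:E).
  move=> hc; apply: continuous_compact_integrable; first exact: segment_compact.
  exact: continuous_subspaceT.
(* Cauchy-Schwarz against the constant 1: integrate 2 D phi <= phi^2 + D^2,
   where the left-hand side has integral 2 D^2. *)
have : (\int[@lebesgue_measure R]_(t in `[0%R, 1%R]) ((2 * D) * phi t)%:E <=
    \int[@lebesgue_measure R]_(t in `[0%R, 1%R]) ((phi t ^+ 2)%:E + (D ^+ 2)%:E))%E.
  apply: le_integral => //.
  - apply: intc => t; apply: cvgMl_tmp; exact: phic.
  - apply: intc => t; apply: cvgD => //; [exact: phi2c|exact: cvg_cst].
  - move=> t _; rewrite -EFinD lee_fin -subr_ge0.
    by rewrite (_ : _ - _ = (phi t - D) ^+ 2) ?sqr_ge0//; ring.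
under eq_integral do rewrite EFinM.
rewrite integralZl//; last exact: intc.
rewrite FTC -EFinM integralD//; [|exact: intc|exact: intc (@cst_continuous _ _ (D ^+ 2))].
rewrite integral_cst//= lebesgue_measure_itv/= lte_fin ltr01 oppr0 adde0 mule1.
rewrite -leeBlDr// -EFinB.
by rewrite (_ : _ - _ = D ^+ 2)//; ring.
Qed.

End smooth_functions.
Arguments dir_derivative {R d} psi v x.

Local Open Scope ereal_scope.

(** * Mean square increments and the Dirichlet energy *)

Section fubini_tonelli_in.
Context {d1 d2} {T1 : measurableType d1} {T2 : measurableType d2}
  {R : realType} (m1 : {sigma_finite_measure set T1 -> \bar R})
  (m2 : {sigma_finite_measure set T2 -> \bar R}) (D : set T2)
  (f : T1 * T2 -> \bar R) (mD : measurable D) (mf : measurable_fun setT f)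
  (f0 : forall z, 0 <= f z).

Let g := f \_ (setT `*` D).

Let mg : measurable_fun setT g.
Proof.
apply/(measurable_restrictT _ _).1; first exact: measurableX.
exact: measurable_funTS.
Qed.

Let gE x y : g (x, y) = if y \in D then f (x, y) else 0.
Proof.
rewrite /g patchE; congr (if _ then _ else _).
by apply/idP/idP => /set_mem H; apply/mem_set; [case: H|split].
Qed.

Let g0 z : 0 <= g z.
Proof. by apply: erestrict_ge0. Qed.

Let int_gE x : \int[m2]_(y in D) f (x, y) = fubini_F m2 g x.
Proof.
rewrite integral_mkcond; apply: eq_integral => y _.
by rewrite gE patchE.
Qed.

Lemma measurable_fun_fubini_in :
  measurable_fun setT (fun x => \int[m2]_(y in D) f (x, y)).
Proof.
under eq_fun do rewrite int_gE.
exact: measurable_fun_fubini_tonelli_F.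
Qed.

Lemma fubini_tonelli_in :
  \int[m1]_x \int[m2]_(y in D) f (x, y) = \int[m2]_(y in D) \int[m1]_x f (x, y).
Proof.
under eq_integral do rewrite int_gE.
rewrite [LHS](fubini_tonelli g)// [RHS]integral_mkcond; apply: eq_integral => y _.
rewrite /fubini_G patchE; under eq_integral do rewrite gE.
by case: ifP => // _; rewrite integral0.
Qed.

End fubini_tonelli_in.

(** The integral of X is the difference of the integrals of its positive and
    negative parts, and it is finite only if both are. *)
Lemma finite_expectation_integrable {d} {T : measurableType d} {R : realType}
    (P : probability T R) (X : T -> R) :
  measurable_fun setT X -> 'E_P[X] \is a fin_num ->
  P.-integrable setT (EFin \o X).
Proof.
move=> mX; rewrite unlock integralE => fX.
have [f1 f2] : \int[P]_w ((EFin \o X)^\+ w) \is a fin_num /\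
               \int[P]_w ((EFin \o X)^\- w) \is a fin_num.
  apply/andP; move: fX.
  have p0 : 0 <= \int[P]_w ((EFin \o X)^\+ w) by exact: integral_ge0.
  have n0 : 0 <= \int[P]_w ((EFin \o X)^\- w) by exact: integral_ge0.
  by case: (\int[P]_w _) p0 => [r||]//; case: (\int[P]_w _) n0 => [s||].
have mEX : measurable_fun setT (EFin \o X) by exact/measurable_EFinP.
apply/integrableP; split => //.
rewrite (_ : (fun x => _) = (fun x => (EFin \o X)^\+ x + (EFin \o X)^\- x)); last first.
  by apply/funext => x; have := congr1 (@^~ x) (fune_abse (EFin \o X)).
rewrite ge0_integralD//; [|exact: measurable_funepos|exact: measurable_funeneg].
by apply: lte_add_pinfty; rewrite ltey_eq ?f1 ?f2.
Qed.

(** Isotropy says that the quadratic form g |-> E (X . g)^2 is the standard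
    one. *)
Lemma expectation_sqr_form {R : realType} {d : nat} {dT : measure_display}
    {T : measurableType dT} (P : probability T R) (X : {RV P >-> 'rV[R]_d})
    (g : 'I_d -> R) : isotropic_rv X ->
  \int[P]_w ((\sum_(i < d) X w ord0 i * g i) ^+ 2)%:E = (\sum_(i < d) g i ^+ 2)%:E.
Proof.
move=> iX; pose M (p : 'I_d * 'I_d) w := (X w ord0 p.1 * X w ord0 p.2)%R.
have mX i : measurable_fun setT (fun w => X w ord0 i).
  by apply: measurableT_comp (measurable_coord _ _) _.
have mM p : measurable_fun setT (M p) by exact: measurable_funM.
have EM p : 'E_P[M p] = ((p.1 == p.2)%:R)%:E.
  have := iX p.1 p.2; rewrite mxE => <-; congr expectation; apply/funext => w.
  by rewrite /M mxE big_ord1 mxE.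
have iM p : P.-integrable setT (EFin \o M p).
  by apply: finite_expectation_integrable => //; rewrite EM.
transitivity (\int[P]_w \sum_(p : 'I_d * 'I_d)
    ((g p.1 * g p.2)%:E * (EFin \o M p) w)).
  apply: eq_integral => w _; rewrite expr2 big_distrlr /= pair_bigA /=.
  by rewrite -sumEFin; apply: eq_bigr => p _; rewrite -EFinM /M; congr EFin; ring.
rewrite integral_sum => [|//|p]; last exact: integrableZl.
transitivity (\sum_(p : 'I_d * 'I_d) ((g p.1 * g p.2) * (p.1 == p.2)%:R)%:E).
  apply: eq_bigr => p _; rewrite integralZl// [RHS]EFinM; congr (_ * _).
  by rewrite -EM unlock.
rewrite sumEFin; congr EFin.
rewrite -(pair_bigA _ (fun i j => g i * g j * (i == j)%:R)%R) /=.
apply: eq_bigr => i _; rewrite (bigD1 i)//= eqxx mulr1 big1 ?addr0// => j ji.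
by rewrite eq_sym (negbTE ji) mulr0.
Qed.

Section test_function.
Context {R : realType} {d : nat} {K : set 'rV[R]_d} {psi : 'rV[R]_d -> R}
  (cK : compact K) (psiS : smooth psi) (psiK : supp psi `<=` K°).

Let leb := @lebesgue_rV R d.

Lemma domain_closed : closed K.
Proof. by apply: compact_closed cK; exact: norm_hausdorff. Qed.

Lemma test_function_out x : ~ K x -> psi x = 0%R.
Proof.
move=> Kx; apply/eqP; apply: contra_notT Kx => px.
by apply: interior_subset; apply: psiK; exact: subset_closure.
Qed.

Lemma partial_out i x : ~ K x -> partial i psi x = 0%R.
Proof.
move=> Kx; rewrite /partial (@near_eq_derive _ _ _ psi (cst 0%R)) ?derive_cst//.
have : nbhs x (~` K).
  by apply: open_nbhs_nbhs; split=> //; rewrite openC; exact: domain_closed.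
by apply: filterS => y; exact: test_function_out.
Qed.

Lemma integral_sqr_setT :
  \int[leb]_(x in K) (psi x ^+ 2)%:E = \int[leb]_x (psi x ^+ 2)%:E.
Proof.
rewrite integral_mkcond; apply: eq_integral => x _; rewrite patchE.
by case: ifPn => //; rewrite notin_setE => /test_function_out ->; rewrite expr0n.
Qed.

Lemma dirichlet_energy_setT :
  dirichlet_energy K psi = \int[leb]_x (sqr_norm_grad psi x)%:E.
Proof.
rewrite /dirichlet_energy integral_mkcond; apply: eq_integral => x _.
rewrite patchE; case: ifPn => //; rewrite notin_setE => Kx.
by rewrite /sqr_norm_grad big1// => i _; rewrite partial_out// expr0n.
Qed.

Lemma measurable_psi : measurable_fun setT psi.
Proof. by apply: continuous_measurable_mx; exact: smooth_continuous. Qed.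

Lemma measurable_partial i : measurable_fun setT (partial i psi).
Proof. by apply: continuous_measurable_mx; exact: partial_continuous. Qed.

Lemma measurable_dir_derivative {d'} {T : measurableType d'}
    (v x : T -> 'rV[R]_d) :
  measurable_fun setT v -> measurable_fun setT x ->
  measurable_fun setT (fun t => dir_derivative psi (v t) (x t)).
Proof.
move=> mv mx; apply: measurable_sum => i; apply: measurable_funM.
  by apply: measurableT_comp (measurable_coord _ _) _.
by apply: measurableT_comp (measurable_partial i) _.
Qed.

Lemma measurable_sqr_increment {d'} {T : measurableType d'}
    (v x : T -> 'rV[R]_d) :
  measurable_fun setT v -> measurable_fun setT x ->
  measurable_fun setT (fun t => ((psi (x t + v t) - psi (x t)) ^+ 2)%:E).
Proof.
move=> mv mx; apply/measurable_EFinP; apply: measurable_funX; apply: measurable_funB.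
  apply: measurableT_comp measurable_psi _; exact: measurable_addmx.
exact: measurableT_comp measurable_psi _.
Qed.

(** Exchange the integral over x with the one over the segment from x to x + v:
    by translation invariance each point of the segment contributes the same. *)
Lemma integral_sqr_increment_le (v : 'rV[R]_d) :
  \int[leb]_x ((psi (x + v) - psi x) ^+ 2)%:E <=
  \int[leb]_x (dir_derivative psi v x ^+ 2)%:E.
Proof.
pose F (z : 'rV[R]_d * measurableTypeR R) : \bar R :=
  (dir_derivative psi v (z.1 + z.2 *: v) ^+ 2)%:E.
have mF : measurable_fun setT F.
  apply/measurable_EFinP; apply: measurable_funX; apply: measurable_dir_derivative.
    exact: measurable_cst.
  apply: measurable_addmx; first exact: measurable_fst.
  by apply: measurable_scalemx; [exact: measurable_snd|exact: measurable_cst].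
have md : measurable_fun setT (fun x => (dir_derivative psi v x ^+ 2)%:E).
  apply/measurable_EFinP; apply: measurable_funX; apply: measurable_dir_derivative => //.
apply: (@le_trans _ _ (\int[leb]_x
    \int[@lebesgue_measure R]_(t in `[0%R, 1%R]) F (x, t))).
  apply: ge0_le_integral => //.
  - by move=> x _; rewrite lee_fin sqr_ge0.
  - by apply: measurable_sqr_increment.
  - apply: (@measurable_fun_fubini_in _ _ _ _ _ (@lebesgue_measure R) _ F) => //.
    by move=> z; rewrite lee_fin sqr_ge0.
  - by move=> x _; exact: sqr_increment_le.
rewrite (@fubini_tonelli_in _ _ _ _ _ leb)//; last first.
  by move=> z; rewrite lee_fin sqr_ge0.
rewrite (_ : (fun t => _) =
    cst (\int[leb]_x (dir_derivative psi v x ^+ 2)%:E)); last first.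
  apply/funext => t; rewrite /F/=.
  apply: (preserves_ge0_integral (lebesgue_rV_shift (t *: v)) md) => x.
  by rewrite lee_fin sqr_ge0.
set I := \int[leb]_x _.
rewrite [leLHS](_ : _ = I * @lebesgue_measure R `[0%R, 1%R]%classic); last first.
  exact: integral_cst.
by rewrite lebesgue_measure_itv/= lte_fin ltr01 oppr0 adde0 mule1.
Qed.

Lemma increment_le_energy {dT : measure_display} {T : measurableType dT}
    (P : probability T R) (X : {RV P >-> 'rV[R]_d}) : isotropic_rv X ->
  \int[P]_w \int[leb]_x ((psi (x + X w) - psi x) ^+ 2)%:E <=
  dirichlet_energy K psi.
Proof.
move=> iX; have mX : measurable_fun setT X by exact: measurable_funPT.
pose F (z : T * 'rV[R]_d) := (dir_derivative psi (X z.1) z.2 ^+ 2)%:E.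
have mF : measurable_fun setT F.
  apply/measurable_EFinP; apply: measurable_funX; apply: measurable_dir_derivative => //.
  exact: measurableT_comp mX _.
have F0 z : 0 <= F z by rewrite lee_fin sqr_ge0.
pose G (z : T * 'rV[R]_d) := ((psi (z.2 + X z.1) - psi z.2) ^+ 2)%:E.
have mG : measurable_fun setT G.
  by apply: measurable_sqr_increment => //; exact: measurableT_comp mX _.
have G0 z : 0 <= G z by rewrite lee_fin sqr_ge0.
apply: (@le_trans _ _ (\int[P]_w fubini_F leb F w)).
  apply: ge0_le_integral => //.
  - by move=> w _; apply: integral_ge0 => x _; exact: (G0 (w, x)).
  - exact: (measurable_fun_fubini_tonelli_F G).
  - exact: (measurable_fun_fubini_tonelli_F F).
  - by move=> w _; exact: integral_sqr_increment_le.
rewrite (fubini_tonelli F)// dirichlet_energy_setT.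
rewrite le_eqVlt; apply/orP; left; apply/eqP; apply: eq_integral => x _.
rewrite /fubini_G /F /dir_derivative /=.
exact: (expectation_sqr_form (fun i => partial i psi x) iX).
Qed.

(** A Poincare inequality: psi and its translate by B + B + 1 in the direction i
    have disjoint supports, so their difference has squared L2 norm 2. *)
Lemma two_le_energy (i : 'I_d) (B : R) :
  (forall x, K x -> `|x ord0 i| <= B)%R -> \int[leb]_(x in K) (psi x ^+ 2)%:E = 1 ->
  2%:E <= ((B + B + 1) ^+ 2)%:E * dirichlet_energy K psi.
Proof.
move=> KB psi1; set M := (B + B + 1)%R.
pose w : 'rV[R]_d := M *: delta_mx ord0 i.
have mpsi2 : measurable_fun setT (fun x => (psi x ^+ 2)%:E).
  by apply/measurable_EFinP; apply: measurable_funX; exact: measurable_psi.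
have psi2_ge0 x : 0 <= (psi x ^+ 2)%:E by rewrite lee_fin sqr_ge0.
have -> : 2%:E = \int[leb]_x ((psi (x + w) - psi x) ^+ 2)%:E.
  transitivity (\int[leb]_x ((psi (x + w) ^+ 2)%:E + (psi x ^+ 2)%:E)).
    rewrite ge0_integralD//=; last first.
      apply: measurableT_comp mpsi2 _; exact: measurable_addmx.
    rewrite (preserves_ge0_integral (lebesgue_rV_shift w) mpsi2)//.
    by rewrite -integral_sqr_setT psi1 -EFinD.
  apply: eq_integral => x _; rewrite -EFinD; congr EFin.
  suff /eqP : (psi (x + w) * psi x = 0)%R.
    by rewrite mulf_eq0 => /orP[]/eqP ->; ring.
  have [Kx|/test_function_out ->] := pselect (K x); last by rewrite mulr0.
  have [Kxw|/test_function_out ->] := pselect (K (x + w)%R); last by rewrite mul0r.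
  exfalso; have := KB _ Kx; have := KB _ Kxw.
  rewrite !mxE !eqxx mulr1 /M !ler_norml => /andP[_ h1] /andP[h2 _].
  by clear -h1 h2; lra.
apply: (le_trans (integral_sqr_increment_le w)).
rewrite dirichlet_energy_setT -ge0_integralZl//; last 3 first.
- apply/measurable_EFinP; apply: measurable_sum => j; apply: measurable_funX.
  exact: measurable_partial.
- by move=> x _; rewrite lee_fin; apply: sumr_ge0 => j _; exact: sqr_ge0.
- by rewrite lee_fin sqr_ge0.
apply: ge0_le_integral => //.
- by move=> x _; rewrite lee_fin sqr_ge0.
- apply/measurable_EFinP; apply: measurable_funX; apply: measurable_dir_derivative => //.
- apply/measurable_EFinP; apply: measurable_funM => //.
  apply: measurable_sum => j; apply: measurable_funX; exact: measurable_partial.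
move=> x _; rewrite lee_fin (_ : dir_derivative psi w x = M * partial i psi x)%R; last first.
  rewrite /dir_derivative (bigD1 i)//= big1 => [|j ji]; last first.
    by rewrite !mxE (negbTE ji) andbF mulr0 mul0r.
  by rewrite !mxE !eqxx mulr1 addr0.
rewrite exprMn ler_wpM2l ?sqr_ge0// /sqr_norm_grad (bigD1 i)//= lerDl.
by apply: sumr_ge0 => j _; exact: sqr_ge0.
Qed.

End test_function.

(** * The random walk confined to a region *)

Section uniform_on.
Context {d} {T : measurableType d} {R : realType} (mu : {measure set T -> \bar R})
  (G : set T) (mG : measurable G) (G1 : mu G = 1).

(** As above, a name of its own keeps the probability structure, which depends
    on G1, away from other restrictions. *)
Definition uniform_measure : set T -> \bar R := mrestr mu mG.

HB.instance Definition _ := Measure.on uniform_measure.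

Let uniform_setT : uniform_measure setT = 1.
Proof. by rewrite /uniform_measure /mrestr setTI. Qed.

HB.instance Definition _ :=
  Measure_isProbability.Build _ _ _ uniform_measure uniform_setT.

Lemma uniform_on_probability :
  exists Q : probability T R, forall A, Q A = mu (A `&` G).
Proof. by exists uniform_measure. Qed.

End uniform_on.

Section restricted_walk.
Context {R : realType} {d : nat}.
Notation E := 'rV[R]_d.
Notation U := ('rV[R]_d * measurableTypeR R)%type.

Definition translate (v : E) (z : U) : U := (z.1 + v, z.2)%R.

Definition phase_measure : set U -> \bar R :=
  @lebesgue_rV R d \x @lebesgue_measure R.

HB.instance Definition _ := Measure.on phase_measure.

Lemma translate_preserves v : preserves_measure phase_measure (translate v).
Proof.
have idP : preserves_measure (@lebesgue_measure R) id by split.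
exact: (preserves_product (lebesgue_rV_shift v) idP).
Qed.

Lemma measurable_translate {d'} {T : measurableType d'} (v : T -> E) (z : T -> U) :
  measurable_fun setT v -> measurable_fun setT z ->
  measurable_fun setT (fun t => translate (v t) (z t)).
Proof.
move=> mv mz; apply: measurable_fun_pair.
  by apply: measurable_addmx => //; exact: measurableT_comp measurable_fst mz.
exact: measurableT_comp measurable_snd mz.
Qed.

Context (G : set U) (mG : measurable G).

(** Requiring z itself to be in G makes the condition symmetric under the exchange
    of z and translate v z, and freezes a walk that starts outside G. *)
Definition admissible (v : E) (z : U) : Prop := G z /\ G (translate v z).

Definition walk_step (v : E) (z : U) : U :=
  if `[< admissible v z >] then translate v z else z.

Lemma measurable_admissible : measurable [set p : E * U | admissible p.1 p.2].
Proof.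
apply: measurableI.
  exact: (measurable_preimage (@measurable_snd _ _ E U) mG).
apply: (measurable_preimage _ mG).
exact: measurable_translate.
Qed.

Lemma measurable_walk_step {d'} {T : measurableType d'} (v : T -> E) (z : T -> U) :
  measurable_fun setT v -> measurable_fun setT z ->
  measurable_fun setT (fun t => walk_step (v t) (z t)).
Proof.
move=> mv mz; apply: measurable_fun_ifT => //.
  apply: (measurable_fun_bool true) => /=; rewrite setTI.
  rewrite (_ : _ @^-1` _ =
      (fun t => (v t, z t)) @^-1` [set p : E * U | admissible p.1 p.2]).
    apply: measurable_preimage measurable_admissible; exact: measurable_fun_pair.
  by apply/seteqP; split=> t /= => [/eqP/eqP/asboolP|/asboolP].
exact: measurable_translate.
Qed.

Context (Q : probability U R) (QE : forall A, Q A = phase_measure (A `&` G)).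

Let overlap (C : set U) (v : E) :=
  phase_measure (C `&` G `&` translate v @^-1` G).

Lemma translateK v : cancel (translate v) (translate (- v)%R).
Proof. by move=> [x y]; rewrite /translate /= addrK. Qed.

Let accept_overlap C v : measurable C ->
  Q [set z | admissible v z /\ C (translate v z)] = overlap C (- v)%R.
Proof.
move=> mC; rewrite QE /overlap.
have [mt tP] := translate_preserves v.
rewrite -[RHS]tP; last first.
  apply: measurableI; first exact: measurableI.
  by apply: measurable_preimage => //; have [] := translate_preserves (- v)%R.
congr phase_measure; apply/seteqP; split => z /=.
  by move=> [[[Gz Gv] Cz] _]; rewrite translateK; split=> //; split.
by rewrite translateK => -[[Cz Gv] Gz]; split=> //; split=> //; split.
Qed.

Let reject_overlap C v : measurable C ->
  overlap C v + Q (C `&` [set z | ~ admissible v z]) = Q C.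
Proof.
move=> mC; rewrite !QE /overlap.
have mt : measurable (translate v @^-1` G).
  by apply: measurable_preimage => //; have [] := translate_preserves v.
have mCG : measurable (C `&` G) by exact: measurableI.
rewrite [RHS](measureDI phase_measure mCG mt).
rewrite [LHS]addeC; congr (phase_measure _ + _).
apply/seteqP; split => z /=.
  by move=> [[Cz na] Gz]; split => // Gv; apply: na; split.
by move=> [[Cz Gz] ng]; split => //; split => // -[_ /ng].
Qed.

(** Detailed balance: the mass that an accepted step v carries into C equals the
    mass in C that an accepted step - v carries away, so averaging over a
    symmetric law of v leaves the uniform law on G invariant. *)
Lemma walk_step_stationary (m : probability E R) (C : set U) :
  preserves_measure m (fun v => - v)%R -> measurable C ->
  (m \x Q) [set p | C (walk_step p.1 p.2)] = Q C.
Proof.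
move=> mN mC.
have mA : measurable [set p : E * U | C p.2 /\ G (translate p.1 p.2)].
  apply: measurableI.
    exact: (measurable_preimage (@measurable_snd _ _ E U) mC).
  by apply: (measurable_preimage _ mG); exact: measurable_translate.
have mo : measurable_fun setT (overlap C).
  rewrite (_ : overlap C =
      Q \o xsection [set p : E * U | C p.2 /\ G (translate p.1 p.2)]).
    exact: measurable_fun_xsection.
  apply/funext => v; rewrite /= QE /overlap; congr phase_measure.
  by apply/seteqP; split=> z /=; rewrite /xsection/= ?inE/= => -[[]].
have mB : measurable [set p : E * U | C p.2 /\ ~ admissible p.1 p.2].
  apply: measurableI.
    exact: (measurable_preimage (@measurable_snd _ _ E U) mC).
  by apply: measurableC; exact: measurable_admissible.
have mr : measurable_fun setT (fun v => Q (C `&` [set z | ~ admissible v z])).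
  rewrite (_ : (fun v => _) =
      Q \o xsection [set p : E * U | C p.2 /\ ~ admissible p.1 p.2]).
    exact: measurable_fun_xsection.
  apply/funext => v /=; congr (Q _).
  by apply/seteqP; split=> z /=; rewrite /xsection/= ?inE.
have madm v : measurable [set z | admissible v z].
  rewrite (_ : mkset _ = xsection [set p : E * U | admissible p.1 p.2] v).
    exact: measurable_xsection measurable_admissible.
  by apply/seteqP; split=> z; rewrite /xsection/= ?inE.
transitivity (\int[m]_v
    (overlap C (- v)%R + Q (C `&` [set z | ~ admissible v z]))).
  apply: eq_integral => v _ /=.
  rewrite -accept_overlap// -measureU//.
  - congr (Q _); apply/seteqP; split=> z; rewrite /xsection/= ?inE/= /walk_step.
      by case: asboolP => [a Cz|na Cz]; [left|right].
    by case=> -[]; case: asboolP.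
  - apply: measurableI; first exact: madm.
    have [mt _] := translate_preserves v.
    exact: (measurable_preimage mt mC).
  - by apply: measurableI => //; apply: measurableC; exact: madm.
  - by apply/seteqP; split=> z //= -[[a _] [_ /(_ a)]].
rewrite (@ge0_integralD _ _ _ m setT)//; last first.
  by have [mNE _] := mN; exact: measurableT_comp mo mNE.
rewrite (preserves_ge0_integral mN mo)//.
rewrite -ge0_integralD//.
under eq_integral do rewrite reject_overlap//.
by rewrite integral_cst//= probability_setT mule1.
Qed.

End restricted_walk.

(** * Independence of the state and the later steps *)

Section stationary_process.
Context {R : realType} {d n : nat} {dT : measure_display} {T : measurableType dT}
  {P : probability T R} (v : 'I_n -> {RV P >-> 'rV[R]_d})
  (vI : mutually_independent v).
Context {dU : measure_display} {U : measurableType dU} (Q : probability U R)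
  (step : 'rV[R]_d -> U -> U)
  (mstep : measurable_fun setT (fun p : 'rV[R]_d * U => step p.1 p.2))
  (stepQ : forall j C, measurable C ->
    (distribution P (v j) \x Q) [set p | C (step p.1 p.2)] = Q C).

Definition state (u : U) (s : seq 'rV[R]_d) : U :=
  foldl (fun z x => step x z) u s.

Let Z (k : nat) (p : T * U) : U := state p.2 (take k [tuple v j p.1 | j < n]).

Let Z0 p : Z 0 p = p.2.
Proof. by rewrite /Z take0. Qed.

Lemma take_steps_S (k : 'I_n) (w : T) :
  take k.+1 [tuple v j w | j < n] = rcons (take k [tuple v j w | j < n]) (v k w).
Proof.
rewrite (take_nth 0%R) ?size_tuple//; congr rcons.
by rewrite -tnth_nth tnth_mktuple.
Qed.

Let ZS (k : 'I_n) p : Z k.+1 p = step (v k p.1) (Z k p).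
Proof. by rewrite /Z take_steps_S /state foldl_rcons. Qed.

Lemma measurable_state k : (k <= n)%N ->
  measurable_fun setT
    (fun p : T * U => state p.2 (take k [tuple v j p.1 | j < n])).
Proof.
elim: k => [_|k IH kn].
  by under eq_fun do rewrite -/(Z 0 _) Z0; exact: measurable_snd.
under eq_fun do rewrite -/(Z k.+1 _) (ZS (Ordinal kn)).
have mv : measurable_fun setT (fun p : T * U => v (Ordinal kn) p.1).
  apply: measurableT_comp measurable_fst; exact: measurable_funPT.
apply: (measurableT_comp mstep (measurable_fun_pair mv (IH (ltnW kn)))).
Qed.

Definition steps_in (J : {set 'I_n}) (B : 'I_n -> set 'rV[R]_d) : set T :=
  \bigcap_(j in [set` J]) (v j @^-1` B j).

Let measurable_steps_in J B :
  (forall j, measurable (B j)) -> measurable (steps_in J B).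
Proof.
move=> mB; apply: fin_bigcap_measurable => // j _.
by apply: (measurable_preimage _ (mB j)); exact: measurable_funPT.
Qed.

Let steps_in_setU1 (k : 'I_n) (J : {set 'I_n}) (B : 'I_n -> set 'rV[R]_d) A :
  k \notin J -> (forall j, measurable (B j)) -> measurable A ->
  exists2 B', (forall j, measurable (B' j)) &
    steps_in (k |: J) B' = (v k @^-1` A) `&` steps_in J B /\
    P (steps_in (k |: J) B') = P (v k @^-1` A) * P (steps_in J B).
Proof.
move=> kJ mB mA; pose B' j := if j == k then A else B j.
have mB' j : measurable (B' j) by rewrite /B'; case: ifP.
exists B' => //; split.
  apply/seteqP; split=> [w /= H|w /= [vA H] j].
    split; first by have := H k; rewrite /= !inE eqxx /B' eqxx; apply.
    move=> j /= jJ; have := H j; rewrite /= !inE jJ orbT /B'.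
    by case: eqP => [jk|_]; [rewrite jk (negbTE kJ) in jJ|apply].
  rewrite /= !inE /B'; case: eqP => [->//|_] /= jJ; exact: H.
rewrite /steps_in (vI (k |: J) mB') (vI J mB) (big_setU1 _ kJ)/= /B' eqxx.
congr (_ * _).
by apply: eq_bigr => j jJ; case: eqP => [jk|//]; rewrite jk (negbTE kJ) in jJ.
Qed.

Let independent_of_later_steps (k : nat) := forall (J : {set 'I_n}) B C,
  (forall j, j \in J -> k <= j)%N -> (forall j, measurable (B j)) ->
  measurable C ->
  (P \x Q) ((Z k @^-1` C) `&` (steps_in J B `*` setT)) = Q C * P (steps_in J B).

(** On a rectangle A `*` C both sides factor: step k joins the later steps, and
    the state is independent of all of them. A product measure is determined by
    its values on rectangles; the factor P (steps_in J B) rescales it. *)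
Let joint_law (k : 'I_n) (J : {set 'I_n}) (B : 'I_n -> set 'rV[R]_d)
    (D : set ('rV[R]_d * U)) :
  independent_of_later_steps k ->
  (forall j, j \in J -> k < j)%N -> (forall j, measurable (B j)) ->
  measurable D ->
  (P \x Q) ([set p | D (v k p.1, Z k p)] `&` (steps_in J B `*` setT)) =
  P (steps_in J B) * (distribution P (v k) \x Q) D.
Proof.
move=> kI kJ mB mD.
have kn : (k <= n)%N by exact: ltnW.
have mW := measurable_steps_in J mB.
have mvZ : measurable_fun setT (fun p : T * U => (v k p.1, Z k p)).
  apply: measurable_fun_pair; last exact: measurable_state.
  apply: measurableT_comp measurable_fst; exact: measurable_funPT.
have mWU : measurable (steps_in J B `*` [set: U]) by exact: measurableX.
pose r : {nonneg R} := NngNum (fine_ge0 (measure_ge0 P (steps_in J B))).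
have rE : r%:num%:E = P (steps_in J B) by rewrite /= fineK// fin_num_measure.
transitivity ((mscale r (distribution P (v k)) \x Q) D).
  apply/esym.
  have [M ME] := pushforward_is_measure (mrestr (P \x Q) mWU) mvZ.
  rewrite (_ : (P \x Q) _ = M D); last by rewrite ME.
  apply: product_measure_unique => // A C mA mC; rewrite ME.
  have kNJ : k \notin J by apply/negP => /kJ; rewrite ltnn.
  have [B' mB' [fE PE]] := steps_in_setU1 kNJ mB mA.
  transitivity ((P \x Q) ((Z k @^-1` C) `&` (steps_in (k |: J) B' `*` setT))).
    congr ((P \x Q) _); rewrite fE; apply/seteqP; split=> p /=.
      by move=> [[Ap Cp] [Wp _]].
    by move=> [Cp [[Ap Wp] _]].
  rewrite kI//; last by move=> j; rewrite !inE => /orP[/eqP ->//|/kJ/ltnW].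
  rewrite PE muleC; congr (_ * _).
  by rewrite muleC -rE.
rewrite -rE; apply: ge0_integral_mscale => //.
exact: measurable_fun_xsection.
Qed.

(** One step applies the walk to a pair that has the product law, and the walk
    preserves Q. *)
Let state_independent k : (k <= n)%N -> independent_of_later_steps k.
Proof.
elim: k => [_|k IH kn] J B C kJ mB mC.
  have -> : Z 0 @^-1` C `&` (steps_in J B `*` setT) = steps_in J B `*` C.
    apply/seteqP; split=> p; rewrite /= Z0.
      by case=> Cp [].
    by case.
  by rewrite product_measure1E//; [rewrite muleC|exact: measurable_steps_in].
pose k' := Ordinal kn.
have mD : measurable [set p : 'rV[R]_d * U | C (step p.1 p.2)].
  exact: (measurable_preimage mstep mC).
have := joint_law (IH (ltnW kn) : independent_of_later_steps k') kJ mB mD.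
rewrite stepQ// muleC => <-; congr ((P \x Q) (_ `&` _)).
by apply/funext => p; rewrite /preimage /mkset /= (ZS k').
Qed.

Lemma state_law (k : 'I_n) (D : set ('rV[R]_d * U)) : measurable D ->
  (P \x Q) [set p | D (v k p.1, state p.2 (take k [tuple v j p.1 | j < n]))] =
  (distribution P (v k) \x Q) D.
Proof.
move=> mD; have kn : (k <= n)%N by exact: ltnW.
have := joint_law (J := finset.set0) (B := fun=> setT)
  (state_independent kn) _ _ mD.
rewrite (_ : steps_in finset.set0 _ = setT); last first.
  by apply/seteqP; split=> // w _ j /=; rewrite inE.
rewrite setXTT setIT probability_setT mul1e; apply => // j.
by rewrite inE.
Qed.

End stationary_process.

(** * The probability of discarding a step *)

Local Close Scope ereal_scope.

(** Here p and q are psi(x) and psi(x + v). The difference of the two sides is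
    the square (s (p + q) - 2 (p - q)) ^ 2 / (8 s), or the same with p and q
    exchanged. *)
Lemma loss_le {R : realType} (s p q : R) : 0 < s ->
  Num.max (p ^+ 2 - q ^+ 2) 0 + q ^+ 2 <=
  (2^-1 + s / 4) * (p ^+ 2 + q ^+ 2) + (2^-1 / s - s / 8) * (q - p) ^+ 2.
Proof.
move=> s0.
have sq (x y : R) : x ^+ 2 <=
    (2^-1 + s / 4) * (x ^+ 2 + y ^+ 2) + (2^-1 / s - s / 8) * (y - x) ^+ 2.
  rewrite -subr_ge0.
  have -> : (2^-1 + s / 4) * (x ^+ 2 + y ^+ 2) + (2^-1 / s - s / 8) * (y - x) ^+ 2
     - x ^+ 2 = (s * (x + y) - 2 * (x - y)) ^+ 2 / (8 * s).
    by field; rewrite gt_eqF.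
  by rewrite divr_ge0 ?sqr_ge0// mulr_ge0// ltW.
case: (leP (p ^+ 2 - q ^+ 2) 0) => _; last by rewrite subrK.
by rewrite add0r [p ^+ 2 + _]addrC -[q - p]opprB sqrrN; exact: sq.
Qed.

Lemma loss_coef_ge0 {R : realType} (s : R) :
  0 < s -> s < 1 -> 0 <= 2^-1 / s - s / 8.
Proof.
move=> s0 s1; rewrite subr_ge0 ler_pdivlMr// mulrAC -expr2.
have s2 : s ^+ 2 <= 1 by apply: exprn_ile1; exact: ltW.
by lra.
Qed.

(** The negative term - s / 8 of the coefficient absorbs the excess s ^+ 4 / 4 of
    the energy over s ^+ 2. *)
Lemma gain_le {R : realType} (s : R) : 0 < s ->
  1 + s / 2 + (2^-1 / s - s / 8) * (s ^+ 2 + (s ^+ 2) ^+ 2 / 4) <= s + 1.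
Proof.
move=> s0; rewrite -subr_ge0.
have -> : s + 1 - (1 + s / 2 + (2^-1 / s - s / 8) * (s ^+ 2 + (s ^+ 2) ^+ 2 / 4))
  = s ^+ 5 / 32 by field; rewrite gt_eqF.
by rewrite divr_ge0// exprn_ge0// ltW.
Qed.

Local Open Scope ereal_scope.

Section subgraph_walk.
Context {R : realType} {d : nat} {K : set 'rV[R]_d} {psi : 'rV[R]_d -> R}
  (psiS : smooth psi) (psiK : supp psi `<=` K°)
  (psi1 : \int[@lebesgue_rV R d]_(x in K) (psi x ^+ 2)%:E = 1).
Notation U := ('rV[R]_d * measurableTypeR R)%type.
Notation leb := (@lebesgue_rV R d).

Definition subgraph : set U := [set z | (0 < z.2 < psi z.1 ^+ 2)%R].

Lemma measurable_subgraph : measurable subgraph.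
Proof.
have mp : measurable_fun setT (fun z : U => psi z.1 ^+ 2)%R.
  apply: measurable_funX; exact: measurableT_comp (measurable_psi psiS) measurable_fst.
have m1 : measurable_fun setT (fun z : U => 0 < z.2)%R.
  by apply: measurable_fun_ltr => //; exact: measurable_snd.
have m2 : measurable_fun setT (fun z : U => z.2 < psi z.1 ^+ 2)%R.
  by apply: measurable_fun_ltr => //; exact: measurable_snd.
apply: (measurable_preimage (measurable_and m1 m2) (A := [set true])) => //.
Qed.

Let mpsi2 : measurable_fun setT (fun x => (psi x ^+ 2)%:E).
Proof. by apply/measurable_EFinP; apply: measurable_funX; exact: measurable_psi. Qed.

Let psi2_ge0 x : 0 <= (psi x ^+ 2)%:E.
Proof. by rewrite lee_fin sqr_ge0. Qed.

Let psi2_setT : \int[leb]_x (psi x ^+ 2)%:E = 1.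
Proof. by rewrite -(integral_sqr_setT psiK). Qed.

Lemma phase_measure_subgraph : phase_measure subgraph = 1.
Proof.
rewrite -psi2_setT; apply: eq_integral => x _ /=.
rewrite (_ : xsection subgraph x = `]0%R, (psi x ^+ 2)%R[%classic).
  rewrite lebesgue_measure_itv/= lte_fin; case: ltP => [_|h].
    by rewrite oppr0 adde0.
  by congr EFin; apply/le_anti; rewrite h sqr_ge0.
by apply/seteqP; split=> y; rewrite /xsection/= ?inE/= ?in_itv.
Qed.

Let out (v : 'rV[R]_d) := subgraph `&` ~` (translate v @^-1` subgraph).

Let mout v : measurable (out v).
Proof.
apply: measurableI; first exact: measurable_subgraph.
apply: measurableC; apply: measurable_preimage measurable_subgraph.
by have [] := @translate_preserves R d v.
Qed.

(** Above a point x, the part of the region that leaves it has heights between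
    psi (x + v) ^+ 2 and psi x ^+ 2. *)
Let out_le (v : 'rV[R]_d) : phase_measure (out v) <=
  \int[leb]_x (Num.max (psi x ^+ 2 - psi (x + v) ^+ 2) 0)%:E.
Proof.
apply: ge0_le_integral => //.
- exact: (measurable_fun_xsection _ (mout v)).
- apply/measurable_EFinP; apply: measurable_maxr => //; apply: measurable_funB.
    exact/measurable_EFinP.
  by apply/measurable_EFinP; apply: measurableT_comp mpsi2 _; exact: measurable_addmx.
move=> x _ /=.
apply: (@le_trans _ _ (lebesgue_measure
    `[(psi (x + v) ^+ 2)%R, (psi x ^+ 2)%R[%classic)).
  apply: le_measure; rewrite ?inE//; first exact: measurable_xsection.
  move=> y /set_mem[/= /andP[y0 yA] /negP].
  by rewrite /= y0/= -leNgt in_itv/= yA => ->.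
rewrite lebesgue_measure_itv/= lte_fin; case: ltP => h.
  by rewrite -EFinB lee_fin le_max lexx.
by rewrite lee_fin le_max lexx orbT.
Qed.

(** The summand 1 is the integral of psi (x + v) ^+ 2; adding it before
    integrating keeps all integrands nonnegative. *)
Lemma rejected_mass_le (s : R) v : (0 < s < 1)%R ->
  phase_measure (subgraph `&` ~` (translate v @^-1` subgraph)) + 1 <=
  (1 + s / 2)%:E + (2^-1 / s - s / 8)%:E *
    \int[leb]_x ((psi (x + v) - psi x) ^+ 2)%:E.
Proof.
move=> /andP[s0 s1].
have mv : measurable_fun setT (fun x : 'rV[R]_d => (psi (x + v) ^+ 2)%:E).
  apply: measurableT_comp mpsi2 _; exact: measurable_addmx.
have psiv : \int[leb]_x (psi (x + v) ^+ 2)%:E = 1.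
  by rewrite (preserves_ge0_integral (lebesgue_rV_shift v) mpsi2).
have md : measurable_fun setT
    (fun x : 'rV[R]_d => ((psi (x + v) - psi x) ^+ 2)%:E).
  exact: measurable_sqr_increment.
have c0 := loss_coef_ge0 s0 s1.
have mmax : measurable_fun setT
    (fun x : 'rV[R]_d => (Num.max (psi x ^+ 2 - psi (x + v) ^+ 2) 0)%R%:E).
  apply/measurable_EFinP; apply: measurable_maxr => //.
  by apply: measurable_funB; exact/measurable_EFinP.
have max0 x : 0 <= (Num.max (psi x ^+ 2 - psi (x + v) ^+ 2) 0)%R%:E.
  by rewrite lee_fin le_max lexx orbT.
rewrite -{1}psiv.
apply: (le_trans (leeD2r _ (out_le v))).
rewrite -ge0_integralD//.
have -> : (1 + s / 2)%:E = (2^-1 + s / 4)%:E *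
    \int[leb]_x ((psi x ^+ 2)%:E + (psi (x + v) ^+ 2)%:E).
  by rewrite ge0_integralD// psi2_setT psiv -EFinD -EFinM; congr EFin; field.
have b0 : (0 <= 2^-1 + s / 4)%R by rewrite addr_ge0// divr_ge0// ltW.
have d0 x : 0 <= ((psi (x + v) - psi x) ^+ 2)%:E by rewrite lee_fin sqr_ge0.
have S0 x : 0 <= (psi x ^+ 2)%:E + (psi (x + v) ^+ 2)%:E by exact: adde_ge0.
have mS : measurable_fun setT
    (fun x : 'rV[R]_d => (psi x ^+ 2)%:E + (psi (x + v) ^+ 2)%:E).
  exact: emeasurable_funD.
rewrite -!ge0_integralZl// -ge0_integralD//; last 4 first.
- by move=> x _; rewrite mule_ge0.
- exact: measurable_funeM.
- by move=> x _; rewrite mule_ge0.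
- exact: measurable_funeM.
apply: ge0_le_integral => //.
- by move=> x _; exact: adde_ge0.
- exact: emeasurable_funD.
- by apply: emeasurable_funD; exact: measurable_funeM.
by move=> x _; rewrite -!EFinD lee_fin; exact: loss_le.
Qed.

End subgraph_walk.
Arguments subgraph {R d} psi.

Section discard_probability.
Context {R : realType} {d : nat} {K : set 'rV[R]_d} {psi : 'rV[R]_d -> R}
  (cK : compact K) (psiS : smooth psi) (psiK : supp psi `<=` K°)
  (psi1 : \int[@lebesgue_rV R d]_(x in K) (psi x ^+ 2)%:E = 1).

Lemma discard_probability_le {dT : measure_display} {T : measurableType dT}
    (P : probability T R) (X : {RV P >-> 'rV[R]_d})
    (Q : probability ('rV[R]_d * measurableTypeR R)%type R) (s : R) :
  (forall A, Q A = phase_measure (A `&` subgraph psi)) ->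
  isotropic_rv X -> (0 < s < 1)%R ->
  dirichlet_energy K psi <= (s ^+ 2 + (s ^+ 2) ^+ 2 / 4)%:E ->
  (distribution P X \x Q) [set p | ~ admissible (subgraph psi) p.1 p.2] <= s%:E.
Proof.
move=> QE iX s01 Es; have /andP[s0 s1] := s01.
set N := [set p | _].
have mX : measurable_fun setT X by exact: measurable_funPT.
have mN : measurable N.
  by apply: measurableC; apply: measurable_admissible; exact: measurable_subgraph.
have mQN : measurable_fun setT (Q \o xsection N) by exact: measurable_fun_xsection.
have QN v : Q (xsection N v) =
    phase_measure (subgraph psi `&` ~` (translate v @^-1` subgraph psi)).
  rewrite QE; congr phase_measure; apply/seteqP; split=> z /=.
    by move=> [/set_mem/= Nz Gz]; split => // tz; apply: Nz.
  by move=> [Gz tz]; split => //; apply/mem_set => /= -[_ /tz].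
have -> : (distribution P X \x Q) N = \int[P]_w Q (xsection N (X w)).
  by rewrite -(ge0_integral_pushforward mX P measurableT mQN).
have mQX : measurable_fun setT (fun w => Q (xsection N (X w))).
  exact: (measurableT_comp mQN mX).
pose D w := \int[@lebesgue_rV R d]_x ((psi (x + X w) - psi x) ^+ 2)%:E.
have mD : measurable_fun setT D.
  pose G (z : T * 'rV[R]_d) := ((psi (z.2 + X z.1) - psi z.2) ^+ 2)%:E.
  apply: (measurable_fun_fubini_tonelli_F G).
    by apply: measurable_sqr_increment => //; exact: measurableT_comp mX _.
  by move=> z; rewrite lee_fin sqr_ge0.
have D0 w : 0 <= D w by apply: integral_ge0 => x _; rewrite lee_fin sqr_ge0.
have c0 := loss_coef_ge0 s0 s1.
have ho : (0 <= 1 + s / 2)%R by rewrite addr_ge0// divr_ge0// ltW.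
have : \int[P]_w (Q (xsection N (X w)) + 1) <=
    \int[P]_w ((1 + s / 2)%:E + (2^-1 / s - s / 8)%:E * D w).
  apply: ge0_le_integral => //.
  - by move=> w _; exact: adde_ge0.
  - exact: emeasurable_funD.
  - by apply: emeasurable_funD => //; exact: measurable_funeM.
  by move=> w _; rewrite QN; exact: (rejected_mass_le psiS psiK psi1).
rewrite ge0_integralD//.
rewrite [in leRHS]ge0_integralD//; last 2 first.
- by move=> w _; rewrite mule_ge0.
- exact: measurable_funeM.
rewrite !integral_cst//= probability_setT !mule1 ge0_integralZl//.
move=> h.
have {}h : \int[P]_w Q (xsection N (X w)) + 1 <= s%:E + 1.
  apply: (le_trans h).
  apply: (@le_trans _ _ ((1 + s / 2)%:E + (2^-1 / s - s / 8)%:E *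
    (s ^+ 2 + (s ^+ 2) ^+ 2 / 4)%:E)).
    rewrite leeD2l// lee_wpmul2l//; apply: le_trans Es.
    exact: (increment_le_energy cK psiS psiK iX).
  rewrite -EFinM -!EFinD lee_fin; exact: gain_le.
by rewrite -(@leeD2rE _ 1).
Qed.

End discard_probability.

(** * The online algorithm *)

Section symmetric_convex.
Context {R : realType} {d : nat} {K : set 'rV[R]_d}
  (convK : @convex_set R 'rV[R]_d K) (symK : K = [set (- x)%R | x in K]).

Lemma half_difference_in x y : K x -> K y -> K (2^-1 *: (x - y))%R.
Proof.
move=> Kx Ky; have KNy : K (- y)%R by rewrite symK; exists y.
have half_ge0 : (0 <= 2^-1 :> R)%R by lra.
have half_le1 : (2^-1 <= 1 :> R)%R by lra.
have := convK (Itv01 half_ge0 half_le1) (mem_set Kx) (mem_set KNy).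
have onem_half : (unstable.onem (2^-1 : R) = 2^-1)%R.
  by rewrite /unstable.onem; lra.
by move=> /set_mem; rewrite /conv/= onem_half -scalerDr.
Qed.

End symmetric_convex.

Section walk_algorithm.
Context {R : realType} {d : nat}.
Notation E := 'rV[R]_d.
Notation U := ('rV[R]_d * measurableTypeR R)%type.
Context (G : set U) (mG : measurable G).

(** The latest step is tested from the state reached by the earlier ones, which
    is recomputed from the internal randomness and the observed steps. *)
Definition walk_decide (u : U) (s : seq E) : bool :=
  `[< admissible G (last 0%R s) (state (walk_step G) u (take (size s).-1 s)) >].

Lemma measurable_state_tuple k i :
  measurable_fun setT
    (fun p : U * k.-tuple E => state (walk_step G) p.1 (take i p.2)).
Proof.
elim: i => [|i IH].
  by under eq_fun do rewrite take0; exact: measurable_fst.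
have [ik|ki] := ltnP i k; last first.
  rewrite (_ : (fun p => _) =
      (fun p : U * k.-tuple E => state (walk_step G) p.1 (take i p.2)))//.
  by apply/funext => p; rewrite !take_oversize// size_tuple// ltnW.
rewrite (_ : (fun p => _) = (fun p : U * k.-tuple E =>
    walk_step G (tnth p.2 (Ordinal ik)) (state (walk_step G) p.1 (take i p.2)))).
  apply: measurable_walk_step => //.
  exact: (measurableT_comp (measurable_tnth (Ordinal ik)) measurable_snd).
apply/funext => p; rewrite (take_nth 0%R) ?size_tuple// /state foldl_rcons.
by rewrite (tnth_nth 0%R).
Qed.

Lemma measurable_walk_decide k :
  measurable_fun setT (fun p : U * k.-tuple E => walk_decide p.1 p.2).
Proof.
apply: (measurable_fun_bool true) => /=; rewrite setTI.
rewrite (_ : _ @^-1` _ =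
    (fun p : U * k.-tuple E =>
      (last 0%R p.2, state (walk_step G) p.1 (take k.-1 p.2)))
    @^-1` [set p : E * U | admissible G p.1 p.2]); last first.
  by apply/seteqP; split=> p; rewrite /preimage/= /walk_decide size_tuple;
    move/asboolP.
apply: measurable_preimage; last exact: measurable_admissible.
apply: measurable_fun_pair; last exact: measurable_state_tuple.
case: k => [|k].
  rewrite (_ : (fun p => _) = cst 0%R)//.
  by apply/funext => p; rewrite (tuple0 p.2).
rewrite (_ : (fun p => _) = (fun p : U * k.+1.-tuple E => tnth p.2 ord_max)).
  exact: (measurableT_comp (measurable_tnth ord_max) measurable_snd).
apply/funext => p; rewrite (tnth_nth 0%R) (last_nth 0%R) size_tuple/=.
by case: (p.2) => -[].
Qed.

Definition walk_algorithm : online_algorithm E U :=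
  OnlineAlgorithm measurable_walk_decide.

Let walk_decide_rcons u s x :
  walk_decide u (rcons s x) = `[< admissible G x (state (walk_step G) u s) >].
Proof. by rewrite /walk_decide last_rcons size_rcons/= -cats1 take_size_cat. Qed.

Lemma accepted_walk n (u : U) (x : n.-tuple E) (j : 'I_n) :
  accepted walk_algorithm u x j =
  `[< admissible G (tnth x j) (state (walk_step G) u (take j x)) >].
Proof.
rewrite /accepted (take_nth 0%R) ?size_tuple// -tnth_nth.
exact: walk_decide_rcons.
Qed.

Lemma state_position n (u : U) (x : n.-tuple E) k : (k <= n)%N ->
  (state (walk_step G) u (take k x)).1 =
  (u.1 + \sum_(j < n | (j < k)%N && accepted walk_algorithm u x j) tnth x j)%R.
Proof.
elim: k => [_|k IH kn]; first by rewrite take0 big_pred0 ?addr0.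
rewrite (take_nth 0%R) ?size_tuple// /state foldl_rcons -/(state _ _ _).
pose k' := Ordinal kn; have := accepted_walk u x k'; have := IH (ltnW kn).
rewrite -[nth _ _ _]/(nth 0%R x k') -tnth_nth -[take k x]/(take k' x).
move: (state _ _ _) => z zE; rewrite /walk_step; case: asboolP => _ acc.
  rewrite /translate /= zE -addrA; congr (_ + _)%R.
  rewrite [RHS](bigD1 k') ?acc ?ltnSn// addrC; congr (_ + _)%R.
  apply: eq_bigl => j; rewrite [in RHS]ltnS (leq_eqVlt j k) -val_eqE.
  by case: (eqVneq (val j) k) => [->|_]; rewrite ?ltnn ?andbF ?andbT.
rewrite zE; congr (_ + _)%R; apply: eq_bigl => j.
rewrite [in RHS]ltnS (leq_eqVlt j k).
case: (eqVneq (val j) k) => [e|//].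
have -> : j = k' by exact/val_inj.
by rewrite acc !andbF.
Qed.

Lemma state_in (u : U) (s : seq E) : G u -> G (state (walk_step G) u s).
Proof.
elim/last_ind: s => [//|s x IH] Gu; rewrite /state foldl_rcons -/(state _ _ _).
by rewrite /walk_step; case: asboolP => [[]//|_]; exact: IH.
Qed.

Lemma state_out (u : U) (s : seq E) : ~ G u -> state (walk_step G) u s = u.
Proof.
move=> Gu; elim/last_ind: s => [//|s x IH].
rewrite /state foldl_rcons -/(state _ _ _).
by rewrite /walk_step IH; case: asboolP => [[/Gu]|].
Qed.

End walk_algorithm.

Section expected_discards.
Context {R : realType} {d n : nat} {dT : measure_display} {T : measurableType dT}
  {P : probability T R} (v : 'I_n -> {RV P >-> 'rV[R]_d}).
Context {dU : measure_display} {U : measurableType dU} (Q : probability U R)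
  (A : online_algorithm 'rV[R]_d U).

Let rejects (j : 'I_n) :=
  [set z : T * U | ~~ accepted A z.2 [tuple v i z.1 | i < n] j].

Lemma expected_discards :
  (forall j, measurable (rejects j)) ->
  'E_(P \x Q)[(fun z : T * U =>
        (num_discarded A z.2 [tuple v j z.1 | j < n])%:R%R)] =
  \sum_(j < n) (P \x Q) (rejects j).
Proof.
move=> mr; rewrite unlock.
transitivity (\int[P \x Q]_z \sum_(j < n) (\1_(rejects j) z)%:E).
  apply: eq_integral => z _; rewrite sumEFin; congr EFin.
  rewrite /num_discarded cardsE -sum1_card natr_sum big_mkcond/=.
  apply: eq_bigr => j _; rewrite indicE; case: ifPn => /= h.
    by rewrite mem_set.
  by rewrite memNset//; apply/negP.
rewrite ge0_integral_sum//; last first.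
  by move=> j; apply/measurable_EFinP; exact: measurable_indic.
by apply: eq_bigr => j _; rewrite integral_indic// setIT.
Qed.

End expected_discards.

Section confined_sums.
Context {R : realType} {d n : nat} {K : set 'rV[R]_d} {dT : measure_display}
  {T : measurableType dT} {P : probability T R} {v : 'I_n -> {RV P >-> 'rV[R]_d}}.

(** The conclusion of the theorem with an arbitrary bound b, since three different
    algorithms are needed, according to the dimension and the eigenvalue. *)
Definition confining_algorithm (b : \bar R) :=
  exists (dU : measure_display) (U : measurableType dU) (Q : probability U R)
         (A : online_algorithm 'rV[R]_d U),
    (forall (u : U) (x : n.-tuple 'rV[R]_d) (k : 'I_n),
       [set (2 *: y)%R | y in K]
         (\sum_(j < n | (j <= k)%N && accepted A u x j) tnth x j)%R) /\
    'E_(P \x Q)[(fun z : T * U =>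
        (num_discarded A z.2 [tuple v j z.1 | j < n])%:R%R)]
      <= b.

Lemma constant_decision_measurable (c : bool) (k : nat) :
  measurable_fun [set: bool * k.-tuple 'rV[R]_d] (fun=> c).
Proof. exact: measurable_cst. Qed.

Definition constant_algorithm (c : bool) : online_algorithm 'rV[R]_d bool :=
  OnlineAlgorithm (decide := fun _ _ => c) (constant_decision_measurable c).

Lemma constant_algorithm_confining (c : bool) (b : \bar R) :
  (forall (x : n.-tuple 'rV[R]_d) (k : 'I_n), [set (2 *: y)%R | y in K]
     (\sum_(j < n | (j <= k)%N && c) tnth x j)%R) ->
  ((~~ c)%:R * n%:R)%R%:E <= b -> confining_algorithm b.
Proof.
move=> HK Hb.
exists _, bool, (\d_true : probability bool R), (constant_algorithm c).
split=> [u x k|]; first exact: HK.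
have rE j : [set z : T * bool | ~~ accepted (constant_algorithm c) z.2
    [tuple v i z.1 | i < n] j] = if c then set0 else setT.
  by rewrite /accepted/=; apply/seteqP; split=> z; case: (c).
rewrite expected_discards => [|j]; last by rewrite rE; case: (c).
apply: le_trans Hb; rewrite (eq_bigr (fun=> (~~ c)%:R%:E)) => [|j _].
  by rewrite sumEFin sumr_const card_ord mulr_natr.
transitivity ((P \x \d_true) (if c then set0 else [set: T * bool])).
  exact: congr1 (rE j).
by case: (c); rewrite ?measure0 ?probability_setT.
Qed.

Context (cK : compact K) (convK : @convex_set R 'rV[R]_d K)
  (symK : K = [set (- x)%R | x in K]) (vI : mutually_independent v)
  (vS : forall j, symmetric_rv (v j)) (vT : forall j, isotropic_rv (v j)).

Lemma walk_algorithm_confining (psi : 'rV[R]_d -> R) (s : R) :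
  K !=set0 -> smooth psi -> supp psi `<=` K° ->
  \int[@lebesgue_rV R d]_(x in K) (psi x ^+ 2)%:E = 1 ->
  (0 < s < 1)%R ->
  dirichlet_energy K psi <= (s ^+ 2 + (s ^+ 2) ^+ 2 / 4)%:E ->
  confining_algorithm (s%:E * n%:R%:E).
Proof.
move=> [x0 Kx0] psiS psiK psi1 s01 Es.
have mG := measurable_subgraph psiS.
have G1 : phase_measure (subgraph psi) = 1.
  exact: (phase_measure_subgraph psiK psi1).
have [Q QE] := uniform_on_probability mG G1.
have GK z : subgraph psi z -> K z.1.
  move=> /andP[z0 zp]; apply: contrapT => /(test_function_out psiK) pz.
  by move: (lt_trans z0 zp); rewrite pz expr0n ltxx.
exists _, _, Q, (walk_algorithm mG); split=> [u x k|].
  have := state_position mG u x (ltn_ord k).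
  under eq_bigl do rewrite ltnS.
  set S := (\sum_(j < n | _) _)%R => uS.
  have SE : S = ((state (walk_step (subgraph psi)) u (take k.+1 x)).1 - u.1)%R.
    by rewrite uS addrAC subrr add0r.
  (* a walk starting outside the region does not move *)
  rewrite SE; set z := state _ _ _.
  exists (2^-1 *: (z.1 - u.1))%R; last by rewrite scalerA divff ?scale1r.
  have [Gu|Gu] := pselect (subgraph psi u).
    by apply: half_difference_in => //; apply: GK => //; exact: state_in.
  rewrite /z (state_out _ Gu) subrr -(subrr x0).
  exact: half_difference_in.
have mN : measurable [set p | ~ admissible (subgraph psi) p.1 p.2].
  by apply: measurableC; exact: measurable_admissible.
have mstep : measurable_fun setT
    (fun p : 'rV[R]_d * _ => walk_step (subgraph psi) p.1 p.2).
  by apply: measurable_walk_step => //.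
have rE j : [set z : T * _ | ~~ accepted (walk_algorithm mG) z.2
    [tuple v i z.1 | i < n] j] =
    [set p : T * _ | ~ admissible (subgraph psi) (v j p.1)
      (state (walk_step (subgraph psi)) p.2 (take j [tuple v i p.1 | i < n]))].
  apply/funext => z; rewrite /mkset accepted_walk tnth_mktuple.
  by apply/propext; split=> /asboolPn.
have law j : (P \x Q) [set z : T * _ | ~~ accepted (walk_algorithm mG) z.2
    [tuple v i z.1 | i < n] j] =
    (distribution P (v j) \x Q) [set p | ~ admissible (subgraph psi) p.1 p.2].
  rewrite rE; apply: (state_law vI mstep _ _ mN) => i C mC.
  apply: walk_step_stationary => //; split.
    exact: measurable_oppmx.
  by move=> B mB; rewrite [RHS]vS.
rewrite expected_discards => [|j].
  apply: (@le_trans _ _ (\sum_(j < n) s%:E)).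
    apply: lee_sum => j _.
    rewrite law.
    exact: (discard_probability_le cK psiS psiK psi1 QE (vT j) s01 Es).
  by rewrite sumEFin sumr_const card_ord -EFinM mulr_natr.
rewrite rE.
apply: (measurable_preimage (f := fun p : T * _ => (v j p.1,
  state (walk_step (subgraph psi)) p.2 (take j [tuple v i p.1 | i < n]))) _ mN).
apply: measurable_fun_pair.
  by apply: measurableT_comp measurable_fst; exact: measurable_funPT.
by apply: measurable_state => //; exact: ltnW.
Qed.

End confined_sums.

(** * The first eigenvalue and the conclusion *)

Lemma compact_coord_bounded {R : realType} {d : nat} (K : set 'rV[R]_d)
    (i : 'I_d) : compact K ->
  exists2 B : R, (0 <= B)%R & forall x, K x -> (`|x ord0 i| <= B)%R.
Proof.
move=> cK; have /compact_bounded : compact ((fun x : 'rV[R]_d => x ord0 i) @` K).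
  apply: continuous_compact cK; apply: continuous_subspaceT; exact: coord_continuous.
move=> [M [Mr MK]]; exists (`|M| + 1)%R; first by rewrite addr_ge0.
move=> x Kx; apply: (MK (`|M| + 1)%R); last by exists x.
by rewrite (le_lt_trans (ler_norm M))// ltrDl.
Qed.

Lemma energy_ge0 {R : realType} {d : nat} (K : set 'rV[R]_d) psi :
  0 <= dirichlet_energy K psi.
Proof.
apply: integral_ge0 => x _; rewrite lee_fin.
by apply: sumr_ge0 => i _; exact: sqr_ge0.
Qed.

Lemma lambda1_gt0 {R : realType} {d : nat} (K : set 'rV[R]_d) :
  compact K -> (0 < d)%N -> 0 < lambda1 K.
Proof.
move=> cK d0; pose i := Ordinal d0.
have [B B0 KB] := compact_coord_bounded i cK.
pose M := ((B + B + 1) ^+ 2)%R.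
have M0 : (0 < M)%R by apply: exprn_gt0; rewrite ltr_wpDl// addr_ge0.
apply: (@lt_le_trans _ _ (2 / M)%:E); first by rewrite lte_fin divr_gt0.
apply: le_ereal_inf_tmp => _ [psi [psiS psiK psi1] <-].
have := two_le_energy cK psiS psiK KB psi1.
by rewrite -/M -lee_pdivrMl// EFinM muleC.
Qed.

Theorem corollary1p2 (R : realType) (d n : nat) (K : set 'rV[R]_d)
    (dT : measure_display) (T : measurableType dT) (P : probability T R)
    (v : 'I_n -> {RV P >-> 'rV[R]_d}) :
  compact K ->
  @convex_set R 'rV[R]_d K ->
  K = [set (- x)%R | x in K] ->
  K° !=set0 ->
  mutually_independent v ->
  (forall j : 'I_n, symmetric_rv (v j)) ->
  (forall j : 'I_n, isotropic_rv (v j)) ->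
  exists (dU : measure_display) (U : measurableType dU) (Q : probability U R)
         (A : online_algorithm 'rV[R]_d U),
    (forall (u : U) (x : n.-tuple 'rV[R]_d) (k : 'I_n),
       [set (2 *: y)%R | y in K]
         (\sum_(j < n | (j <= k)%N && accepted A u x j) tnth x j)%R) /\
    'E_(P \x Q)[(fun z : T * U =>
        (num_discarded A z.2 [tuple v j z.1 | j < n])%:R%R)]
      <= sqrte (lambda1 K) * n%:R%:E.
Proof.
move=> cK convK symK [x0 /interior_subset Kx0] vI vS vT.
change (@confining_algorithm R d n K dT T P v (sqrte (lambda1 K) * n%:R%:E)).
have [d0|d0] := posnP d.
  (* in dimension 0 there is only one vector, so nothing need be discarded *)
  apply: (constant_algorithm_confining (c := true)) => [x k|].
    exists x0 => //; apply/rowP => i.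
    by exfalso; case: i => i; rewrite d0.
  by rewrite mul0r mule_ge0// sqrte_ge0.
have l0 := lambda1_gt0 cK d0.
have [l1|l1] := leP 1 (lambda1 K).
  (* the bound is at least n *)
  apply: (constant_algorithm_confining (c := false)) => [x k|].
    exists 0%R; last first.
      by rewrite scaler0 big_pred0// => j; rewrite andbF.
    have := half_difference_in convK symK Kx0 Kx0.
    by rewrite subrr scaler0.
  rewrite mul1r -[leLHS]mul1e lee_wpmul2r// ?lee_fin//.
  have sqrte1 : sqrte 1 = 1 :> \bar R by rewrite /sqrte sqrtr1.
  by rewrite -{1}sqrte1 lee_sqrt// ltW.
have [l lE] : exists l, lambda1 K = l%:E.
  exists (fine (lambda1 K)); rewrite fineK// ge0_fin_numE ?(ltW l0)//.
  by rewrite (lt_trans l1)// ltry.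
move: l0 l1; rewrite lE !lte_fin => l0 l1.
have : lambda1 K < (l + l ^+ 2 / 4)%:E.
  by rewrite lE lte_fin ltrDl divr_gt0// exprn_gt0.
move=> /ereal_inf_lt[_ [psi [psiS psiK psi1] <-] /ltW El].
have sl : (Num.sqrt l ^+ 2 = l)%R by rewrite sqr_sqrtr// ltW.
apply: (walk_algorithm_confining cK convK symK vI vS vT _ psiS psiK psi1).
- by exists x0.
- by rewrite sqrtr_gt0 l0/= -sqrtr1 ltr_sqrt.
- by rewrite sl.
Qed.
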